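(* Let $K$ be a field of characteristic zero, let $d\geq 1$, let $\lambda_1,\dots,\lambda_d\in K$ be pairwise distinct, let $\alpha_1\geq\alpha_2\geq\cdots\geq\alpha_d\geq 1$ be integers, and for $1\le j\le d$, $1\le i\le\alpha_j$ let $m_{ji}\ge 1$ be integers. Let $R=K[y^i_{j,h} : 1\le j\le d,\ 1\le i\le\alpha_j,\ 1\le h\le m_{ji}]$ be the polynomial ring in these variables, and let $M$ be the $2$-row matrix \[ M=\Big(J^1_{\lambda_1,m_{11}}\big|\cdots\big|J^{\alpha_1}_{\lambda_1,m_{1\alpha_1}}\big|J^1_{\lambda_2,m_{21}}\big|\cdots\big|J^{\alpha_2}_{\lambda_2,m_{2\alpha_2}}\big|\cdots\big|J^1_{\lambda_d,m_{d1}}\big|\cdots\big|J^{\alpha_d}_{\lambda_d,m_{d\alpha_d}}\Big) \] obtained by concatenating the Jordan blocks \[ J^i_{\lambda_j,m_{ji}}= \begin{pmatrix} y^i_{j,1} & y^i_{j,2} & \cdots & y^i_{j,m_{ji}}\\ \lambda_j y^i_{j,1} & y^i_{j,1}+\lambda_j y^i_{j,2} & \cdots & y^i_{j,m_{ji}-1}+\lambda_j y^i_{j,m_{ji}} \end{pmatrix}. \] Put $\alpha=\sum_{j=1}^d\alpha_j$ (the number of blocks) and $N=\sum_{j=1}^d\sum_{i=1}^{\alpha_j}m_{ji}$ (the number of variables). Let $I_2(M)\subseteq R$ be the ideal generated by the $2$-minors of $M$. Then \[ \mathrm{cd}(I_2(M))=\mathrm{ara}(I_2(M))= \begin{cases}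 N-\alpha & \text{if } d=1,\\ N-1 & \text{if } d>1. \end{cases} \]
   Context: For an ideal $I$ of a Noetherian commutative ring $R$, the cohomological dimension is $\mathrm{cd}(I)=\mathrm{cd}_R(I)=\max\{i\in\mathbb{Z} : H^i_I(R)\neq 0\}$, where $H^i_I(R)$ is the $i$-th local cohomology module of $R$ with support in $I$. The arithmetical rank $\mathrm{ara}(I)$ is the smallest integer $s\ge 0$ for which there exist $a_1,\dots,a_s\in R$ with $\sqrt{I}=\sqrt{(a_1,\dots,a_s)}$. *)

(* Defs.v *)
From HB Require Import structures.
From mathcomp Require Import all_boot all_order all_algebra.
From mathcomp Require Import mpoly.

Set Implicit Arguments.
Unset Strict Implicit.
Unset Printing Implicit Defensive.

Import GRing.Theory.
Local Open Scope ring_scope.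

(* Subsets and ideals of a commutative ring are Prop-valued predicates. *)
Section Ideals.
Variable R : comNzRingType.
Implicit Types (S I : R -> Prop) (x : R).

Definition ideal_gen S x : Prop :=
  exists n (c g : 'I_n -> R),
    (forall i, S (g i)) /\ x = \sum_(i < n) c i * g i.

(* For n = 0 the empty product makes this the unit ideal. *)
Definition ideal_pow I n : R -> Prop :=
  ideal_gen (fun x => exists a : 'I_n -> R,
                        (forall i, I (a i)) /\ x = \prod_(i < n) a i).

Definition radical I x : Prop := exists n, I (x ^+ n).

Definition generated_up_to_radical I (s : nat) : Prop :=
  exists a : 'I_s -> R,
    forall x, radical I x <-> radical (ideal_gen (fun y => exists i, y = a i)) x.

(* ara(I) = s *)
Definition is_ara I (s : nat) : Prop :=
  generated_up_to_radical I s /\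
  forall t, generated_up_to_radical I t -> (s <= t)%N.

Definition minors_ideal (k p q : nat) (M : 'M[R]_(p, q)) : R -> Prop :=
  ideal_gen (fun x => exists (f : 'I_k -> 'I_p) (g : 'I_k -> 'I_q),
    [/\ {homo f : i j / (i < j)%N}, {homo g : i j / (i < j)%N}
      & x = \det (mxsub f g M)]).

End Ideals.

(* Local cohomology as the right derived functors of the I-torsion functor
   Gamma_I, computed on injective resolutions. *)
Section LocalCohomology.
Variable R : comNzRingType.
Implicit Types (I : R -> Prop) (M : lmodType R).

Definition injective_module (E : lmodType R) : Prop :=
  forall (A B : lmodType R) (u : {linear A -> B}) (f : {linear A -> E}),
    injective u -> exists g : {linear B -> E}, forall a, g (u a) = f a.

Record injective_resolution M := InjectiveResolution {
  res_obj : nat -> lmodType R;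
  res_aug : {linear M -> res_obj 0};
  res_d : forall n, {linear res_obj n -> res_obj n.+1};
  res_obj_injective : forall n, injective_module (res_obj n);
  res_aug_injective : injective res_aug;
  res_exact0 : forall x, res_d 0 x = 0 <-> exists y, res_aug y = x;
  res_exactS : forall n x, res_d n.+1 x = 0 <-> exists y, res_d n y = x
}.

Definition torsion I M (x : M) : Prop :=
  exists n, forall a, ideal_pow I n a -> a *: x = 0.

Definition torsion_cocycle I M (E : injective_resolution M) n
    (x : res_obj E n) : Prop :=
  torsion I x /\ res_d E n x = 0.

Definition torsion_coboundary I M (E : injective_resolution M) n :
    res_obj E n -> Prop :=
  match n with
  | 0 => fun x => x = 0
  | k.+1 => fun x => exists2 y : res_obj E k, torsion I y & res_d E k y = x
  end.

(* H^n_I(M) <> 0, where H^n_I(M) is the n-th cohomology of Gamma_I(E), that is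
   cocycles modulo coboundaries. It does not depend on the resolution E, so
   its negation says that the quotient vanishes for every E. *)
Definition local_cohomology_neq0 I M (n : nat) : Prop :=
  exists (E : injective_resolution M) (x : res_obj E n),
    torsion_cocycle I x /\ ~ torsion_coboundary I x.

(* cd(I) = c; negative degrees are omitted, H^i_I(R) being 0 there. *)
Definition is_cd I (c : nat) : Prop :=
  local_cohomology_neq0 I (R^o : lmodType R) c /\
  forall n, local_cohomology_neq0 I (R^o : lmodType R) n -> (n <= c)%N.

End LocalCohomology.

(* Indices start at 0; ord_pred h is the cyclic predecessor, so its value at
   h = 0 is discarded. *)
Definition jordan_block (K : comNzRingType) (A : lalgType K) (lambda : K)
    (m : nat) (y : 'I_m -> A) : 'M[A]_(2, m) :=
  \matrix_(r < 2, h < m)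
    if r == 0 then y h
    else (if (0 < h)%N then y (ord_pred h) else 0) + lambda *: y h.

Section JordanMatrix.
Variables (K : fieldType) (d : nat) (lambda : 'I_d -> K) (alpha : 'I_d -> nat).
Variable m : forall j : 'I_d, 'I_(alpha j) -> nat.

Definition num_blocks : nat := \sum_(j < d) alpha j.

Definition num_vars : nat := \sum_(j < d) \sum_(i < alpha j) m i.

(* The variable y^i_{j,h}; tagnat.Rank lists the triples (j, i, h)
   lexicographically, so these are all the variables, without repetition. *)
Definition jvar (j : 'I_d) (i : 'I_(alpha j)) (h : 'I_(m i)) :
    {mpoly K[num_vars]} :=
  'X_(tagnat.Rank (p_ := fun j => \sum_(i < alpha j) m i) j
       (tagnat.Rank (p_ := fun i => m i) i h)).

Definition jordan_matrix : 'M[{mpoly K[num_vars]}]_(2, num_vars) :=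
  \mxrow_(j < d) \mxrow_(i < alpha j) jordan_block (lambda j) (@jvar j i).

End JordanMatrix.

(* Main.v *)
(* Call a variable live if it is the last one of its block and dead otherwise,
   and color it by the eigenvalue of the block.  The minors of two neighbouring
   columns of a block show one after the other that the dead variables lie in
   the radical of I = I_2(M); modulo these, the minor of the columns of u and v
   is a multiple of x_u x_v by the difference of the eigenvalues.  So I is, up
   to radical, generated by the dead variables and the x_u x_v with u and v
   live of different colors: V(I) is a union of d coordinate subspaces which
   meet pairwise in the origin.

   For d = 1 only the dead variables remain.  For d > 1 the Schmitt-Vogel lemma
   collects the generators into N - 1 sums.  This bounds ara(I), hence cd(I),
   since H^n_I vanishes for n greater than the number of generators up to
   radical.  Conversely, separating one color from the others writes V(I) as a
   union of two sets meeting in the origin, and the Mayer-Vietoris sequence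
   lifts the nonzero module H^N of the origin to H^(N-1)_I.

   Local cohomology is computed by element chases in an arbitrary injective
   resolution; resolutions exist because the coinduced modules Hom_K(R, M) are
   injective. *)

Require Import Defs.
From HB Require Import structures.
From mathcomp Require Import boolp classical_sets.
From mathcomp Require Import all_boot all_order all_algebra.
From mathcomp Require Import mpoly.
From mathcomp Require Import zify ring.

Set Implicit Arguments.
Unset Strict Implicit.
Unset Printing Implicit Defensive.

Import Order.TTheory GRing.Theory.
Local Open Scope ring_scope.

(** * Injective modules over an algebra over a field *)

Section Submodules.
Variables (R : comNzRingType) (M : lmodType R).

Definition submodule (P : M -> Prop) :=
  [/\ P 0, forall x y, P x -> P y -> P (x + y) & forall r x, P x -> P (r *: x)].

Definition submod (P : M -> Prop) (_ : submodule P) := {x : M | `[< P x >]}.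

Variables (P : M -> Prop) (hP : submodule P).

HB.instance Definition _ := SubChoice.on (submod hP).

Lemma submod_closedP : GRing.submod_closed (fun x : M => `[< P x >]).
Proof.
case: hP => h0 hD hZ; split=> [|r x y]; rewrite !unfold_in.
  exact/asboolP.
by move=> /asboolP hx /asboolP hy; apply/asboolP/hD => //; apply: hZ.
Qed.

HB.instance Definition _ :=
  GRing.SubChoice_isSubLmodule.Build R M _ (submod hP) submod_closedP.

End Submodules.

Section Injectives.
Variables (R : comNzRingType) (E : lmodType R).

(** [G] is the graph of a linear map from an ideal of R to E. As a submodule of R x E it embeds into
    R by the first projection, and an extension of the second projection to R is determined by its
    value [w] at 1. *)
Lemma injective_extension (G : R -> E -> Prop) :
  injective_module E ->
  G 0 0 -> (forall r s x y, G r x -> G s y -> G (r + s) (x + y)) ->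
  (forall c r x, G r x -> G (c * r) (c *: x)) ->
  (forall x, G 0 x -> x = 0) ->
  exists w : E, forall r x, G r x -> r *: w = x.
Proof.
move=> injE G0 GD GZ Gf.
pose P (p : (R^o * E)%type) := G p.1 p.2.
have hP : submodule P by split=> [//|[r x] [s y]|c [r x]]; [apply: GD|apply: GZ].
pose u : submod hP -> R^o := fst \o val.
pose f : submod hP -> E := snd \o val.
have ulin : linear u by [].
have flin : linear f by [].
pose uL := GRing.isLinear.Build _ _ _ _ u ulin.
pose fL := GRing.isLinear.Build _ _ _ _ f flin.
pose u' : {linear submod hP -> R^o} := HB.pack u uL.
pose f' : {linear submod hP -> E} := HB.pack f fL.
have uinj : injective u'.
  move=> p q /eqP; rewrite -subr_eq0 => /eqP hpq; apply/eqP; rewrite -subr_eq0.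
  have /asboolP := valP (p - q); rewrite /P.
  rewrite (_ : (val (p - q)).1 = 0) => [/Gf h|]; last by [].
  by apply/eqP/val_inj; rewrite [LHS]surjective_pairing h; congr pair.
have [g hg] := injE _ _ u' f' uinj.
exists (g 1) => r x Grx; rewrite -linearZ /=.
have hp : `[< P (r, x) >] by apply/asboolP.
have := hg (exist _ (r, x) hp); rewrite /= /u /f /=; move=> <-; congr (g _).
by rewrite /GRing.scale /= mulr1.
Qed.

End Injectives.

(** * Linear algebra over K and injective resolutions *)

Section KLinear.
Variables (R : comNzRingType) (K : fieldType) (iota : {rmorphism K -> R}).

Definition klinear (M N : lmodType R) (f : M -> N) :=
  (forall x y, f (x + y) = f x + f y) /\
  (forall c x, f (iota c *: x) = iota c *: f x).

(** A partial K-linear map from M to N, encoded by its graph so that Zorn's lemma applies to sets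
    under inclusion. *)
Definition klinear_graph (M N : lmodType R) (G : set (M * N)) :=
  [/\ G (0, 0), forall p q, G p -> G q -> G (p + q),
      forall c p, G p -> G (iota c *: p) & forall y, G (0, y) -> y = 0].

(** The chain condition for Zorn's lemma. Joining [G] covers the empty chain, and any two points of
    the union lie in a common member joined with [G]. *)
Lemma klinear_graph_bigcup (M N : lmodType R) (G : set (M * N))
    (F : set (set (M * N))) :
  klinear_graph G -> (forall X, F X -> klinear_graph (X `|` G)%classic) ->
  total_on F (@classical_sets.subset _) ->
  klinear_graph (\bigcup_(X in F) X `|` G)%classic.
Proof.
move=> hG hF tF; have [G0 GD GZ Gf] := hG.
have up X : F X -> forall p, (X `|` G)%classic p ->
    (\bigcup_(X in F) X `|` G)%classic p.
  by move=> FX p [Xp|Gp]; [left; exists X|right].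
have inX p : (\bigcup_(X in F) X `|` G)%classic p ->
    G p \/ exists2 X, F X & (X `|` G)%classic p.
  by case=> [[X FX Xp]|Gp]; [right; exists X => //; left|left].
split=> [|p q|c p|y].
- by right.
- move=> /inX[Gp|[X FX Xp]] /inX[Gq|[Y FY Yq]].
  + by right; apply: GD.
  + by apply: (up Y) => //; have [_ h _ _] := hF _ FY; apply: h => //; right.
  + by apply: (up X) => //; have [_ h _ _] := hF _ FX; apply: h => //; right.
  + case: (tF _ _ FX FY) => [XY|YX].
      apply: (up Y) => //; have [_ h _ _] := hF _ FY; apply: h => //.
      by case: Xp => [/XY|]; [left|right].
    apply: (up X) => //; have [_ h _ _] := hF _ FX; apply: h => //.
    by case: Yq => [/YX|]; [left|right].
- move=> /inX[Gp|[X FX Xp]]; first by right; apply: GZ.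
  by apply: (up X) => //; have [_ _ h _] := hF _ FX; apply: h.
- by move=> /inX[/Gf//|[X FX Xp]]; have [_ _ _ h] := hF _ FX; apply: h.
Qed.

(** The new vector [x0] is sent to 0. If a nonzero multiple of [x0] were in the domain already, so
    would be [x0], as K is a field. *)
Lemma klinear_graph_adjoin (M N : lmodType R) (G : set (M * N)) (x0 : M) :
  klinear_graph G -> (forall y, ~ G (x0, y)) ->
  klinear_graph
    [set p | exists2 q, G q & exists c, p = (q.1 + iota c *: x0, q.2)].
Proof.
move=> [G0 GD GZ Gf] hx0; split=> [|p q [p' Gp [a ->]] [q' Gq [b ->]]|
  c p [p' Gp [a ->]]|y [[x z] Gx [a [hx ->]]]].
- by exists (0, 0) => //; exists 0; rewrite rmorph0 scale0r addr0.
- exists (p' + q'); first exact: GD.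
  by exists (a + b); rewrite rmorphD scalerDl /= addrACA.
- exists (iota c *: p'); first exact: GZ.
  by exists (c * a); rewrite rmorphM -scalerA -scalerDr.
- have [a0|a0] := eqVneq a 0.
    move: hx Gx; rewrite a0 rmorph0 scale0r addr0 /= => <-.
    exact: Gf.
  case: (hx0 (iota (- a^-1) *: z)).
  have := GZ (- a^-1) _ Gx; congr (G _); congr pair => /=.
  have -> : x = - (iota a *: x0) by apply/eqP; rewrite -addr_eq0 -hx.
  by rewrite scalerN scalerA -rmorphM mulNr mulVf // rmorphN rmorph1 scaleN1r opprK.
Qed.

Lemma klinear_extension (M N : lmodType R) (G : set (M * N)) :
  klinear_graph G ->
  exists2 g : M -> N, klinear g & forall x y, G (x, y) -> g x = y.
Proof.
move=> hG.
have [|A [hA maxA]] := @Zorn_bigcup _ (fun X => klinear_graph (X `|` G)%classic).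
  by move=> F FP tF; apply: klinear_graph_bigcup.
pose Z := (A `|` G)%classic.
have tot x : exists y, Z (x, y).
  apply: contrapT => hx.
  have hx' y : ~ Z (x, y) by move=> Zxy; apply: hx; exists y.
  have hZ' := klinear_graph_adjoin hA hx'.
  set Z' := [set p | _]%classic in hZ'.
  have ZZ' : (Z `<=` Z')%classic.
    move=> p Zp; exists p => //; exists 0.
    by rewrite rmorph0 scale0r addr0 -surjective_pairing.
  apply: (maxA Z').
    split=> [p Ap|Z'A]; first by apply: ZZ'; left.
    apply: (hx' 0); left; apply: Z'A; exists (0, 0); first by case: hA.
    by exists 1; rewrite rmorph1 scale1r add0r.
  by rewrite setUidl // => p Gp; apply: ZZ'; right.
have [g hg] := choice tot.
have [Z0 ZD ZZ Zf] := hA.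
have uniqZ x y y' : Z (x, y) -> Z (x, y') -> y = y'.
  move=> h h'; apply/eqP; rewrite -subr_eq0; apply/eqP/Zf.
  have -> : (0, y - y') = (x, y) + iota (- 1) *: (x, y') :> M * N.
    by rewrite rmorphN rmorph1 scaleN1r -[RHS]/(x - x, y - y') subrr.
  exact: ZD h (ZZ _ _ h').
exists g; first split=> [x y|c x].
- by apply: uniqZ (hg _) _; exact: (ZD (x, g x) (y, g y) (hg x) (hg y)).
- by apply: uniqZ (hg _) _; exact: (ZZ c (x, g x) (hg x)).
- by move=> x y Gxy; apply: uniqZ (hg x) _; right.
Qed.

Section Coinduced.
Variable M : lmodType R.

Record coinduced := Coinduced { coind_val :> R^o -> M; _ : klinear coind_val }.

Lemma coindP (f : coinduced) : klinear f. Proof. by case: f. Qed.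

Lemma coind_ext (f g : coinduced) : f =1 g -> f = g.
Proof.
case: f g => [f hf] [g hg] /= /funext e; case: _ / e in hg *.
by congr Coinduced; apply: Prop_irrelevance.
Qed.

HB.instance Definition _ := gen_eqMixin coinduced.
HB.instance Definition _ := gen_choiceMixin coinduced.

Lemma coind_zero_subproof : klinear (fun _ : R^o => 0 : M).
Proof. by split=> [x y|c x]; rewrite ?addr0 ?scaler0. Qed.

Lemma coind_opp_subproof (f : coinduced) : klinear (fun x => - f x).
Proof.
by have [fD fZ] := coindP f; split=> [x y|c x]; rewrite ?fD ?opprD ?fZ ?scalerN.
Qed.

Lemma coind_add_subproof (f g : coinduced) : klinear (fun x => f x + g x).
Proof.
have [fD fZ] := coindP f; have [gD gZ] := coindP g.
by split=> [x y|c x]; rewrite ?fD ?gD ?fZ ?gZ ?scalerDr // addrACA.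
Qed.

Lemma coind_scale_subproof (r : R) (f : coinduced) :
  klinear (fun x : R^o => f (r *: x)).
Proof.
have [fD fZ] := coindP f; split=> [x y|c x]; first by rewrite scalerDr fD.
by rewrite scalerA mulrC -scalerA fZ.
Qed.

Definition coind_zero := Coinduced coind_zero_subproof.
Definition coind_opp f := Coinduced (coind_opp_subproof f).
Definition coind_add f g := Coinduced (coind_add_subproof f g).
Definition coind_scale r f := Coinduced (coind_scale_subproof r f).

Fact coind_addA : associative coind_add.
Proof. by move=> f g h; apply: coind_ext => x /=; rewrite addrA. Qed.
Fact coind_addC : commutative coind_add.
Proof. by move=> f g; apply: coind_ext => x /=; rewrite addrC. Qed.
Fact coind_add0 : left_id coind_zero coind_add.
Proof. by move=> f; apply: coind_ext => x /=; rewrite add0r. Qed.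
Fact coind_addN : left_inverse coind_zero coind_opp coind_add.
Proof. by move=> f; apply: coind_ext => x /=; rewrite addNr. Qed.

HB.instance Definition _ := GRing.isZmodule.Build coinduced
  coind_addA coind_addC coind_add0 coind_addN.

Fact coind_scaleA a b f : coind_scale a (coind_scale b f) = coind_scale (a * b) f.
Proof. by apply: coind_ext => x /=; rewrite scalerA mulrC. Qed.
Fact coind_scale1 : left_id 1 coind_scale.
Proof. by move=> f; apply: coind_ext => x /=; rewrite scale1r. Qed.
Fact coind_scaleDr : right_distributive coind_scale +%R.
Proof. by move=> a f g; apply: coind_ext. Qed.
Fact coind_scaleDl f : {morph coind_scale^~ f : a b / a + b}.
Proof.
by move=> a b; apply: coind_ext => x /=; rewrite scalerDl; have [-> _] := coindP f.
Qed.

HB.instance Definition _ := GRing.Zmodule_isLmodule.Build R coinduced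
  coind_scaleA coind_scale1 coind_scaleDr coind_scaleDl.

(** The adjunction Hom_R(B, Hom_K(R, M)) = Hom_K(B, M), given by evaluation at 1, reduces this to
    extending a K-linear map from A to B. *)
Lemma coinduced_injective : injective_module coinduced.
Proof.
move=> A B u f uinj.
pose G : set (B * M) := [set p | exists a, p = (u a, (f a : coinduced) 1)]%classic.
have hG : klinear_graph G.
  split=> [|p q [a ->] [b ->]|c p [a ->]|y [a [ua ->]]].
  - by exists 0; rewrite !linear0.
  - by exists (a + b); rewrite !linearD.
  - exists (iota c *: a); rewrite !linearZ /=; congr pair.
    by have [_ <-] := coindP (f a).
  - suff -> : a = 0 by rewrite linear0.
    by apply: uinj; rewrite linear0.
have [g [gD gZ] hg] := klinear_extension hG.
have gP b : klinear (fun r : R^o => g (r *: b)).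
  split=> [x y|c x]; first by rewrite scalerDl gD.
  by rewrite -scalerA gZ.
pose h b := Coinduced (gP b).
have hlin : linear h.
  move=> r x y; apply: coind_ext => z /=.
  by rewrite scalerDr gD scalerA [_ * _]mulrC.
pose hL := GRing.isLinear.Build _ _ _ _ h hlin.
exists (HB.pack h hL : {linear B -> coinduced}) => a.
apply: coind_ext => r /=; apply: hg; exists (r *: a).
rewrite !linearZ /=; congr pair; congr (_ _ _).
by rewrite /GRing.scale /= mulr1.
Qed.

End Coinduced.

(* With a K-linear map [rho] of kernel N, the map x |-> (r |-> rho (r x)) is
   R-linear, and it has kernel N because N is a submodule. *)
Lemma injective_cokernel (E : lmodType R) (N : E -> Prop) :
  submodule N ->
  exists (E' : lmodType R) (d : {linear E -> E'}),
    injective_module E' /\ forall x, d x = 0 <-> N x.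
Proof.
move=> hN; have [N0 ND NZ] := hN.
pose G : set (E * submod hN) := [set p | p.1 = val p.2]%classic.
have hG : klinear_graph G.
  split=> [//|p q|c p|y] /=; first by rewrite /G /= => -> ->.
    by rewrite /G /= => ->.
  by move=> y0; apply: val_inj; rewrite -y0.
have [p [pD pZ] hp] := klinear_extension hG.
pose rho x := x - val (p x).
have rhoP x : klinear (fun r : R^o => rho (r *: x)).
  split=> [r s|c r]; rewrite /rho; first by rewrite scalerDl pD opprD addrACA.
  by rewrite -scalerA pZ scalerBr.
have rhoN x : rho x = 0 <-> N x.
  split=> [/eqP|Nx].
    by rewrite subr_eq0 => /eqP ->; apply/asboolP/(valP (p x)).
  have /asboolP Nx' := Nx; apply/eqP; rewrite subr_eq0; apply/eqP.
  by rewrite (hp x (exist _ x Nx')).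
pose d x := Coinduced (rhoP x).
have dlin : linear d.
  move=> r x y; apply: coind_ext => z /=; rewrite /rho.
  by rewrite !(scalerDr, pD) scalerA [z * r]mulrC opprD addrACA.
pose dL := GRing.isLinear.Build _ _ _ _ d dlin.
exists (coinduced E), (HB.pack d dL : {linear E -> coinduced E}).
split=> [|x]; first exact: coinduced_injective.
split=> [dx|Nx].
  have := congr1 (fun f : coinduced E => f 1) dx.
  by rewrite /= scale1r => /rhoN.
by apply: coind_ext => r /=; apply/rhoN/NZ.
Qed.

Lemma injective_embedding (M : lmodType R) :
  exists (E : lmodType R) (u : {linear M -> E}),
    injective_module E /\ injective u.
Proof.
have N0 : submodule (fun x : M => x = 0).
  by split=> [//|x y -> ->|r x ->]; rewrite ?addr0 ?scaler0.
have [E [u [injE hu]]] := injective_cokernel N0.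
exists E, u; split=> // x y /eqP; rewrite -subr_eq0 -linearB => /eqP /hu /eqP.
by rewrite subr_eq0 => /eqP.
Qed.

Lemma injective_resolution_exists (M : lmodType R) :
  inhabited (injective_resolution M).
Proof.
(* A state is the last module built along with the image of the map into it, which the next
   differential must have as its kernel. *)
pose S := {E : lmodType R & {N : E -> Prop | submodule N}}.
have next (s : S) : {E' : lmodType R & {d : {linear projT1 s -> E'} |
    injective_module E' /\ forall x, d x = 0 <-> sval (projT2 s) x}}.
  have /cid[E'] := injective_cokernel (proj2_sig (projT2 s)).
  by move=> /cid[d h]; exists E', d.
have imP (A B : lmodType R) (f : {linear A -> B}) :
    submodule (fun x => exists y, f y = x).
  split=> [|x y [a <-] [b <-]|r x [a <-]]; first by exists 0; rewrite linear0.
    by exists (a + b); rewrite linearD.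
  by exists (r *: a); rewrite linearZ.
have /cid[E0 /cid[u [injE0 uinj]]] := injective_embedding M.
pose step (s : S) : S := existT _ (projT1 (next s))
  (exist _ _ (imP _ _ (sval (projT2 (next s))))).
pose St n : S := iter n step (existT _ E0 (exist _ _ (imP _ _ u))).
pose d n : {linear projT1 (St n) -> projT1 (St n.+1)} := sval (projT2 (next (St n))).
have dP n x : d n x = 0 <-> sval (projT2 (St n)) x.
  by case: (proj2_sig (projT2 (next (St n)))).
have injS n : injective_module (projT1 (St n)).
  by case: n => // n; case: (proj2_sig (projT2 (next (St n)))).
exact: (inhabits (@InjectiveResolution R M (fun n => projT1 (St n)) u d injS uinj
  (dP 0) (fun n => dP n.+1))).
Qed.

End KLinear.

(** * Ideals and torsion *)

Section IdealTheory.
Variable R : comNzRingType.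
Implicit Types (I J S : R -> Prop) (r x y : R) (a : seq R).

Definition is_ideal J :=
  [/\ J 0, forall x y, J x -> J y -> J (x + y) & forall r x, J x -> J (r * x)].

Lemma ideal_opp J : is_ideal J -> forall x, J x -> J (- x).
Proof. by move=> [_ _ JM] x Jx; rewrite -mulN1r; apply: JM. Qed.

Lemma ideal_sum J : is_ideal J -> forall (T : finType) (F : T -> R) (P : pred T),
  (forall t, P t -> J (F t)) -> J (\sum_(t | P t) F t).
Proof. by move=> [J0 JD _] T F P h; apply: big_ind. Qed.

Lemma ideal_gen_ideal S : is_ideal (ideal_gen S).
Proof.
split=> [|x y [n [c [g [Sg ->]]]] [m [c' [g' [Sg' ->]]]]|r x [n [c [g [Sg ->]]]]].
- by exists 0%N, (fun=> 0), (fun=> 0); split=> [[]//|]; rewrite big_ord0.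
- exists (n + m)%N, (fun i => match split i with inl j => c j | inr j => c' j end),
    (fun i => match split i with inl j => g j | inr j => g' j end).
  split=> [i|]; first by case: split.
  rewrite big_split_ord /=; congr (_ + _); apply: eq_bigr => i _.
    by rewrite (unsplitK (inl i)).
  by rewrite (unsplitK (inr i)).
- exists n, (fun i => r * c i), g; split=> //.
  by rewrite mulr_sumr; apply: eq_bigr => i _; rewrite mulrA.
Qed.

Lemma ideal_gen_sub S x : S x -> ideal_gen S x.
Proof.
by move=> Sx; exists 1%N, (fun=> 1), (fun=> x); split=> //; rewrite big_ord1 mul1r.
Qed.

Lemma ideal_gen_min S J x :
  is_ideal J -> (forall y, S y -> J y) -> ideal_gen S x -> J x.
Proof.
move=> hJ SJ [n [c [g [Sg ->]]]]; apply: ideal_sum => // i _.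
by case: hJ => _ _; apply; apply: SJ.
Qed.

Lemma radical_ideal I : is_ideal I -> is_ideal (radical I).
Proof.
move=> hI; have [I0 ID IM] := hI.
split=> [|x y [n xn] [m ym]|r x [n xn]].
- by exists 1%N; rewrite expr1.
- exists (n + m)%N; rewrite exprDn; apply: ideal_sum => // i _.
  rewrite -mulr_natl; apply: (IM); have [im|mi] := leqP m i.
    by rewrite -(subnK im) exprD mulrA; apply: (IM).
  have -> : (n + m - i = (m - i) + n)%N by have := ltn_ord i; lia.
  by rewrite exprD mulrAC; apply: (IM).
- by exists n; rewrite exprMn; apply: IM.
Qed.

Lemma radical_sub I x : I x -> radical I x.
Proof. by exists 1%N. Qed.

Lemma radicalX I x n : radical I (x ^+ n) -> radical I x.
Proof. by move=> [m h]; exists (n * m)%N; rewrite exprM. Qed.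

Fixpoint in_span a r : Prop :=
  if a is b :: a' then exists c s, in_span a' s /\ r = c * b + s else r = 0.

Lemma in_span_ideal a : is_ideal (in_span a).
Proof.
elim: a => [|b a [h0 hD hM]] /=.
  by split=> [//|x y -> ->|r x ->]; rewrite ?addr0 ?mulr0.
split=> [|x y [c [s [sa ->]]] [c' [s' [sa' ->]]]|r x [c [s [sa ->]]]].
- by exists 0, 0; rewrite mul0r addr0.
- by exists (c + c'), (s + s'); split; [apply: hD|ring].
- by exists (r * c), (r * s); split; [apply: hM|ring].
Qed.

Lemma in_span_mem a x : x \in a -> in_span a x.
Proof.
elim: a => [//|b a IH]; rewrite inE => /predU1P[->|/IH xa] /=.
  by exists 1, 0; have [? _ _] := in_span_ideal a; rewrite mul1r addr0.
by exists 0, x; rewrite mul0r add0r.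
Qed.

Lemma in_span_min a J x :
  is_ideal J -> (forall y, y \in a -> J y) -> in_span a x -> J x.
Proof.
move=> [J0 JD JM]; elim: a x => [|b a IH] x aJ /=; first by move->.
move=> [c [s [sa ->]]]; apply: JD; first by apply/JM/aJ/mem_head.
by apply: IH => // y ya; apply: aJ; rewrite inE ya orbT.
Qed.

Lemma generated_up_to_radical_seq I a :
  is_ideal I -> (forall y, y \in a -> radical I y) ->
  (forall x, I x -> radical (in_span a) x) -> generated_up_to_radical I (size a).
Proof.
move=> hI aI Ia; exists (fun i => nth 0 a i) => x; split=> [[n xn]|[n xn]].
  apply: (@radicalX _ _ n); have [m h] := Ia _ xn; exists m.
  apply: in_span_min h; first exact: ideal_gen_ideal.
  move=> y ya; apply: ideal_gen_sub.
  by rewrite -index_mem in ya; exists (Ordinal ya); rewrite nth_index -?index_mem.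
apply: (@radicalX _ _ n); apply: ideal_gen_min xn; first exact: radical_ideal.
by move=> y [i ->]; apply/aI/mem_nth.
Qed.

Definition noetherian := forall J : nat -> R -> Prop,
  (forall n, is_ideal (J n)) -> (forall n x, J n x -> J n.+1 x) ->
  exists n, forall k x, J k x -> J n x.

(** The colon ideals of J by the powers of b form an ascending chain. *)
Lemma colon_stable J b : noetherian -> is_ideal J ->
  exists l, forall k r, J (b ^+ k * r) -> J (b ^+ l * r).
Proof.
move=> hR [J0 JD JM]; apply: hR => [n|n x]; last by rewrite exprS -mulrA; apply: JM.
split=> [|x y|r x]; first by rewrite mulr0.
  by rewrite mulrDr; apply: JD.
by rewrite mulrCA; apply: JM.
Qed.

End IdealTheory.

(** * Torsion with respect to a finite list of elements *)

Section Torsion.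
Variable R : comNzRingType.
Implicit Types (M E : lmodType R) (a b : seq R).

(* For a finitely generated ideal this is the torsion of the ideal, see
   [torsionP]; visibly it depends on the radical only. *)
Definition tors a M (x : M) := forall y, y \in a -> exists k, y ^+ k *: x = 0.

Lemma ann_ideal M (x : M) : is_ideal (fun r => r *: x = 0).
Proof.
split=> [|r s hr hs|r s hs]; first exact: scale0r.
  by rewrite scalerDl hr hs addr0.
by rewrite -scalerA hs scaler0.
Qed.

Lemma tors_submodule a M : submodule (@tors a M).
Proof.
split=> [y _|x z ax az y ya|r x ax y ya]; first by exists 0%N; rewrite scaler0.
  have [k hk] := ax y ya; have [l hl] := az y ya; exists (k + l)%N.
  by rewrite scalerDr {1}addnC !exprD -!scalerA hk hl !scaler0 addr0.
by have [k hk] := ax y ya; exists k; rewrite scalerA mulrC -scalerA hk scaler0.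
Qed.

Lemma torsB a M (x y : M) : tors a x -> tors a y -> tors a (x - y).
Proof.
have [_ hD hZ] := tors_submodule a M; move=> ax ay.
by apply: hD => //; rewrite -scaleN1r; apply: hZ.
Qed.

Lemma tors_linear a M (N : lmodType R) (f : {linear M -> N}) x :
  tors a x -> tors a (f x).
Proof.
by move=> ax y /ax[k hk]; exists k; rewrite -linearZ hk linear0.
Qed.

Lemma tors_cons c a M (x : M) :
  tors (c :: a) x <-> (exists k, c ^+ k *: x = 0) /\ tors a x.
Proof.
split=> [h|[hb ha] y]; last by rewrite inE => /predU1P[->|/ha].
by split=> [|y ya]; apply: h; rewrite inE ?eqxx ?ya ?orbT.
Qed.

(** Induction on the sum of the exponents [f y] with which the generators kill the vector: when one
    factor of the product is expanded, each generator in it lowers its own exponent by one. *)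
Lemma tors_prod a M (x : M) : tors a x ->
  exists n, forall c : 'I_n -> R, (forall i, in_span a (c i)) ->
    (\prod_i c i) *: x = 0.
Proof.
move=> ax; have /choice[e he] : forall y, exists k, y \in a -> y ^+ k *: x = 0.
  move=> y; have [ya|] := boolP (y \in a); last by exists 0%N.
  by have [k hk] := ax y ya; exists k.
suff H (n : nat) : forall (f : R -> nat) (z : M),
    (forall y, y \in a -> y ^+ f y *: z = 0) ->
    (\sum_(y <- a) f y <= n)%N -> forall c : 'I_n.+1 -> R,
    (forall i, in_span a (c i)) -> (\prod_i c i) *: z = 0.
  by exists (\sum_(y <- a) e y).+1; exact: H he (leqnn _).
elim: n => [|n IH] {ax}f {}x {}he hn c ca.
  rewrite big_ord1; have := ca ord0.
  apply: (@in_span_min _ _ (fun t => t *: x = 0)) => [|y ya].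
    exact: ann_ideal.
  move: hn; rewrite leqn0 sum_nat_seq_eq0 => /allP/(_ y ya)/= /eqP ey.
  by have := he y ya; rewrite ey scale1r => ->; rewrite scaler0.
rewrite big_ord_recr -scalerA /=; set p := (X in X *: _).
have := ca ord_max.
apply: (@in_span_min _ _ (fun t => p *: (t *: x) = 0)) => [|y ya].
  split=> [|r s hr hs|r s hs]; first by rewrite scale0r scaler0.
    by rewrite scalerDl scalerDr hr hs addr0.
  by rewrite -scalerA scalerA mulrC -scalerA hs scaler0.
have [ey|ey] := eqVneq (f y) 0%N.
  by have := he y ya; rewrite ey scale1r => ->; rewrite !scaler0.
apply: (IH (fun z => if z == y then (f z).-1 else f z)) => [z za||i].
- have [->|zy] := eqVneq z y.
    by rewrite scalerA -exprSr prednK ?lt0n // -?zy he.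
  by rewrite scalerA mulrC -scalerA he // scaler0.
- rewrite -ltnS; apply: leq_trans hn.
  rewrite !(big_rem y ya) /= eqxx -addSn prednK ?lt0n // leq_add2l.
  by apply: leq_sum => t _; case: eqP => // _; apply: leq_pred.
- exact: ca.
Qed.

Lemma tors_radical a b M (x : M) :
  (forall y, y \in b -> radical (in_span a) y) -> tors a x -> tors b x.
Proof.
move=> ba /tors_prod[n hn] y /ba[k yk]; exists (k * n)%N.
rewrite exprM; have := hn (fun=> y ^+ k) (fun=> yk).
by rewrite prodr_const card_ord.
Qed.

(** The hypotheses place (a) between I and its radical; [tors_prod] replaces the exponents of the
    single generators by one power of I. *)
Lemma torsionP (I : R -> Prop) a M (x : M) :
  (forall r, I r -> in_span a r) -> (forall y, y \in a -> radical I y) ->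
  torsion I x <-> tors a x.
Proof.
move=> Ia aI; split=> [[n hn] y /aI[k yk]|/tors_prod[n hn]].
  exists (k * n)%N; rewrite exprM; apply: hn; apply: ideal_gen_sub.
  by exists (fun=> y ^+ k); split=> //; rewrite prodr_const card_ord.
exists n => r hr; apply: (ideal_gen_min (ann_ideal x) _ hr).
by move=> _ [c [Ic ->]]; apply: hn => i; apply: Ia.
Qed.

(** Makes [local_cohomology_bound] applicable to any family that generates I up to radical, which
    bounds ara(I) from below. *)
Lemma torsion_generators (I : R -> Prop) a t (f : 'I_t -> R) :
  is_ideal I ->
  (forall r, I r -> in_span a r) -> (forall y, y \in a -> radical I y) ->
  (forall x, radical I x <-> radical (ideal_gen (fun y => exists i, y = f i)) x) ->
  forall M (x : M), torsion I x <-> tors (codom f) x.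
Proof.
move=> hI Ia aI hf M x; split=> [[n hn] y /codomP[i ->]|hx].
  have /hf[k yk] : radical (ideal_gen (fun y => exists i, y = f i)) (f i).
    by apply/radical_sub/ideal_gen_sub; exists i.
  exists (k * n)%N; rewrite exprM; apply: hn; apply: ideal_gen_sub.
  by exists (fun=> f i ^+ k); split=> //; rewrite prodr_const card_ord.
apply/(torsionP _ Ia aI); apply: tors_radical hx => y /aI /hf [k yk].
exists k; apply: ideal_gen_min yk; first exact: in_span_ideal.
by move=> _ [i ->]; apply/in_span_mem/codom_f.
Qed.

End Torsion.

(** * Division and decomposition in injective modules *)

Section InjectiveModules.
Variables (R : comNzRingType) (E : lmodType R).
Hypothesis injE : injective_module E.

(* Extends the map b r + j |-> r z, for j in J, from the ideal b R + J to R. *)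
Lemma injective_divide (J : R -> Prop) b (z : E) :
  is_ideal J -> (forall r, J (b * r) -> r *: z = 0) ->
  exists2 w : E, b *: w = z & forall j, J j -> j *: w = 0.
Proof.
move=> hJ hz; have [J0 JD JM] := hJ.
pose G r (x : E) := exists s, J (r - b * s) /\ x = s *: z.
have [||c r _ [s [hs ->]]|x [s [hs ->]]|w hw] := @injective_extension _ E G injE.
- by exists 0; rewrite mulr0 subr0 scale0r.
- move=> r1 r2 _ _ [s1 [h1 ->]] [s2 [h2 ->]]; exists (s1 + s2).
  by split; [have := JD _ _ h1 h2; congr (J _); ring|rewrite scalerDl].
- exists (c * s); split; last by rewrite scalerA.
  by have := JM c _ hs; congr (J _); ring.
- by apply: hz; have := ideal_opp hJ hs; congr (J _); ring.
exists w => [|j Jj].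
  by apply: hw; exists 1; rewrite mulr1 subrr scale1r.
by apply: hw; exists 0; rewrite mulr0 subr0 scale0r.
Qed.

(* Extends the map l + c |-> c z from the ideal L + C to R. *)
Lemma injective_glue (L C : R -> Prop) (z : E) :
  is_ideal L -> is_ideal C -> (forall r, L r -> C r -> r *: z = 0) ->
  exists w : E, (forall l, L l -> l *: w = 0) /\ (forall c, C c -> c *: w = c *: z).
Proof.
move=> hL hC hz; have [L0 LD LM] := hL; have [C0 CD CM] := hC.
pose G r (x : E) := exists c, [/\ C c, L (r - c) & x = c *: z].
have [||c r _ [s [Cs hs ->]]|x [s [Cs hs ->]]|w hw] := @injective_extension _ E G injE.
- by exists 0; rewrite subr0 scale0r.
- move=> r1 r2 _ _ [s1 [C1 h1 ->]] [s2 [C2 h2 ->]]; exists (s1 + s2).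
  split; [exact: CD|have := LD _ _ h1 h2; congr (L _); ring|by rewrite scalerDl].
- exists (c * s); split; [exact: CM|by rewrite -mulrBr; apply: LM|].
  by rewrite scalerA.
- by apply: hz => //; have := ideal_opp hL hs; congr (L _); ring.
exists w; split=> [l Ll|c Cc]; apply: hw.
  by exists 0; rewrite subr0 scale0r.
by exists c; rewrite subrr.
Qed.

Hypothesis noethR : noetherian R.

(* Says that the a-torsion of E maps onto its localization at b. *)
Lemma tors_divide a b k (z : E) : tors a z ->
  exists w l, tors a w /\ b ^+ l *: (z - b ^+ k *: w) = 0.
Proof.
move=> az; have [l hl] := colon_stable b noethR (ann_ideal z).
have [||w hw hJ] := @injective_divide (fun r => r *: z = 0) (b ^+ (l + k)) (b ^+ l *: z).
- exact: ann_ideal.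
- by move=> r /hl h; rewrite scalerA mulrC.
exists w, l; split=> [y /az[m hm]|]; first by exists m; apply: hJ.
by rewrite scalerBr scalerA -exprD hw subrr.
Qed.

(* A substitute for the Artin-Rees lemma: L is built from J by adjoining one
   after the other high powers of the elements of a. *)
Lemma ideal_separation (a : seq R) (J C : R -> Prop) :
  is_ideal J -> is_ideal C ->
  (forall c, C c -> forall u, u \in a -> exists t, J (u ^+ t * c)) ->
  exists L, [/\ is_ideal L, forall r, J r -> L r,
    forall r, L r -> C r -> J r & forall u, u \in a -> exists l, L (u ^+ l)].
Proof.
move=> hJ hC; elim: a => [|b a IH] hCa.
  by exists J; split.
have [|L [hL JL LC La]] := IH.
  by move=> c Cc u ua; apply: hCa => //; rewrite inE ua orbT.
have [l hl] := colon_stable b noethR hL.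
have [L0 LD LM] := hL; have [C0 CD CM] := hC.
exists (fun r => exists s, L (r - b ^+ l * s)); split.
- split=> [|x y [s xs] [t yt]|r x [s xs]].
  + by exists 0; rewrite mulr0 subr0.
  + by exists (s + t); have := LD _ _ xs yt; congr (L _); ring.
  + by exists (r * s); have := LM r _ xs; congr (L _); ring.
- by move=> r Jr; exists 0; rewrite mulr0 subr0; apply: JL.
(* For some t, b^t c is in J and so in L; hence b^(t+l) s is in L. By the choice of [l] so is b^l s,
   and with it c. *)
- move=> c [s hs] Cc; apply: LC => //.
  have [t ht] := hCa c Cc b (mem_head _ _).
  have {ht} /JL ht := ht.
  suff /hl h : L (b ^+ (t + l) * s) by have := LD _ _ hs h; congr (L _); ring.
  have := LD _ _ ht (ideal_opp hL (LM (b ^+ t) _ hs)); congr (L _).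
  by rewrite exprD; ring.
- move=> u; rewrite inE => /predU1P[->|/La[k hk]].
    by exists l, 1; rewrite mulr1 subrr.
  by exists k, 0; rewrite mulr0 subr0.
Qed.

(** Let J be the annihilator of z and C the ideal of all c with c z torsion for [a]. An ideal L that
    contains powers of [a] and meets C within J allows gluing 0 on L to c |-> c z on C. The result
    [w] is torsion for [a], and C, which contains powers of the elements of [b], kills z - w. *)
Lemma tors_split (a b : seq R) (z : E) :
  (forall u v, u \in a -> v \in b -> exists k, (u * v) ^+ k *: z = 0) ->
  exists z1 z2, [/\ z = z1 + z2, tors a z1 & tors b z2].
Proof.
move=> hz; pose J r := r *: z = 0.
pose C c := forall u, u \in a -> exists t, J (u ^+ t * c).
have hJ : is_ideal J by apply: ann_ideal.
have [J0 JD JM] := hJ.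
have hC : is_ideal C.
  split=> [u _|x y Cx Cy u ua|r x Cx u ua].
  - by exists 0%N; rewrite mulr0.
  - have [s hs] := Cx u ua; have [t ht] := Cy u ua; exists (s + t)%N.
    have := JD _ _ (JM (u ^+ t) _ hs) (JM (u ^+ s) _ ht); congr (J _).
    by rewrite exprD; ring.
  - by have [t ht] := Cx u ua; exists t; rewrite mulrCA; apply: JM.
have [|L [hL JL LC La]] := @ideal_separation a J C hJ hC; first by [].
have [|w [Lw Cw]] := @injective_glue L C z hL hC; first exact: LC.
exists w, (z - w); rewrite addrC subrK; split=> [//|u /La[k hk]|v vb].
  by exists k; apply: Lw.
have /choice[e he] : forall u, exists k, u \in a -> (u * v) ^+ k *: z = 0.
  move=> u; have [ua|] := boolP (u \in a); last by exists 0%N.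
  by have [k hk] := hz u v ua vb; exists k.
(* [K] dominates all exponents [e u], so that v^K lies in C. *)
pose K := (\sum_(u <- a) e u)%N; exists K.
rewrite scalerBr Cw ?subrr // => u ua; exists K.
rewrite -exprMn /J; have eK : (e u <= K)%N.
  by rewrite /K (big_rem u) //= leq_addr.
by rewrite -(subnK eK) exprD -scalerA he ?scaler0.
Qed.

End InjectiveModules.

(** * Torsion cohomology of injective resolutions *)

Section Acyclicity.
Variables (R : comNzRingType) (M : lmodType R) (E : injective_resolution M).
Local Notation d := (res_d E _).

Lemma res_d_d n (x : res_obj E n) : d (d x) = 0.
Proof. by apply/res_exactS; exists x. Qed.

(* The induction step is the long exact sequence of
   0 -> Gamma_(b, a) E -> Gamma_a E -> (Gamma_a E)_b -> 0. *)
Lemma tors_acyclic (a : seq R) k (x : res_obj E k.+1) :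
  noetherian R -> (size a <= k)%N -> tors a x -> d x = 0 ->
  exists2 y : res_obj E k, tors a y & d y = x.
Proof.
move=> noethR; elim: a k x => [|b a IH] k x ak ax dx.
  by have /res_exactS[y yx] := dx; exists y.
have /tors_cons[[m bx] {}ax] := ax.
have [y ay yx] := IH k x (ltnW ak) ax dx.
case: k => [//|k] in x y ak dx bx ax ay yx *.
have [_ hD hZ] := tors_submodule a (res_obj E k.+1).
(* Since b^m kills x, b^m y is a cocycle, hence d z. Up to b-power torsion z is b^m w, and then a
   power of b kills y - d w. *)
have [||z az zy] := IH k (b ^+ m *: y) ak; first exact: hZ.
  by rewrite linearZ /= yx.
have [w [l [aw hw]]] := tors_divide (@res_obj_injective _ _ E k) noethR b m az.
exists (y - d w); last by rewrite linearB /= res_d_d subr0.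
apply/tors_cons; split; last by apply: torsB => //; apply: tors_linear.
exists (l + m)%N; rewrite exprD -scalerA scalerBr -zy -[b ^+ m *: d w]linearZ.
by rewrite -linearB -linearZ /= hw linear0.
Qed.

Lemma local_cohomology_bound (I : R -> Prop) (a : seq R) n : noetherian R ->
  (forall (N : lmodType R) (x : N), torsion I x <-> tors a x) ->
  forall x : res_obj E n, torsion_cocycle I x -> ~ torsion_coboundary I x ->
  (n <= size a)%N.
Proof.
move=> noethR Ia; case: n => [//|n] x [/Ia ax dx] hx; rewrite ltnNge.
apply/negP => an; apply: hx.
by have [y /Ia ay yx] := tors_acyclic noethR an ax dx; exists y.
Qed.

(** This is Hom(R/(a), N); on the resolution E its cohomology is Ext(R/(a), M). *)
Definition kill (a : seq R) (N : lmodType R) (x : N) :=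
  forall y, y \in a -> y *: x = 0.

Lemma kill_submodule a (N : lmodType R) : submodule (@kill a N).
Proof.
split=> [y _|x z ax az y ya|r x ax y ya]; first by rewrite scaler0.
  by rewrite scalerDr ax ?az ?addr0.
by rewrite scalerA mulrC -scalerA ax ?scaler0.
Qed.

Lemma kill_linear a (N N' : lmodType R) (f : {linear N -> N'}) x :
  kill a x -> kill a (f x).
Proof. by move=> ax y /ax hy; rewrite -linearZ hy linear0. Qed.

Lemma kill_cons c a (N : lmodType R) (x : N) :
  kill (c :: a) x <-> c *: x = 0 /\ kill a x.
Proof.
split=> [h|[hc ha] y]; last by rewrite inE => /predU1P[->|/ha].
by split=> [|y ya]; apply: h; rewrite inE ?eqxx ?ya ?orbT.
Qed.

Lemma kill_span a (N : lmodType R) (x : N) r : kill a x -> in_span a r -> r *: x = 0.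
Proof.
by move=> ax; apply: (@in_span_min _ _ (fun t => t *: x = 0)); first exact: ann_ideal.
Qed.

(** Regularity is read from the end of the list, so that consing adds the next nonzerodivisor. *)
Fixpoint regular (a : seq R) : Prop :=
  if a is b :: a' then
    regular a' /\ (forall r, in_span a' (b * r) -> in_span a' r)
  else True.

(** Multiplication by b is injective on R/(a), hence surjective on Hom(R/(a), N) for injective N. *)
Lemma kill_divide a b (N : lmodType R) (z : N) : injective_module N ->
  (forall r, in_span a (b * r) -> in_span a r) -> kill a z ->
  exists2 w : N, b *: w = z & kill a w.
Proof.
move=> injN breg az.
have [|w wz aw] := injective_divide injN (in_span_ideal a) (b := b) (z := z).
  by move=> r /breg; apply: kill_span.
by exists w => // y ya; apply/aw/in_span_mem.
Qed.

Definition kill_coboundary (a : seq R) n : res_obj E n -> Prop :=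
  match n with
  | 0 => fun x => x = 0
  | k.+1 => fun x => exists2 y : res_obj E k, kill a y & d y = x
  end.

Lemma kill_coboundary_submodule a n : submodule (@kill_coboundary a n).
Proof.
case: n => [|n] /=.
  by split=> [//|x y -> ->|r x ->]; rewrite ?addr0 ?scaler0.
have [k0 kD kZ] := kill_submodule a (res_obj E n).
split=> [|x y [u au <-] [v av <-]|r x [u au <-]].
- by exists 0 => //; rewrite linear0.
- by exists (u + v); [apply: kD|rewrite linearD].
- by exists (r *: u); [apply: kZ|rewrite linearZ].
Qed.

Lemma kill_coboundary_kill a n (x : res_obj E n) :
  kill_coboundary a x -> kill a x.
Proof.
case: n x => [|n] x /=; first by move=> -> y _; rewrite scaler0.
by move=> [y ay <-]; apply: kill_linear.
Qed.

Lemma kill_coboundary_cocycle a n (x : res_obj E n) :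
  kill_coboundary a x -> d x = 0.
Proof.
case: n x => [|n] x /=; first by move=> ->; rewrite linear0.
by move=> [y _ <-]; apply: res_d_d.
Qed.

Lemma kill_coboundary_divide a b n (x : res_obj E n) :
  (forall r, in_span a (b * r) -> in_span a r) -> kill_coboundary a x ->
  exists2 y : res_obj E n, kill_coboundary a y & b *: y = x.
Proof.
move=> breg; case: n x => [|n] x /=.
  by move=> ->; exists 0; rewrite ?scaler0.
move=> [z az <-]; have [w wz aw] := kill_divide (@res_obj_injective _ _ E n) breg az.
by exists (d w); [exists w|rewrite -linearZ wz].
Qed.

End Acyclicity.

(** * Nonvanishing in the top degree for a regular sequence *)

Section TopCohomology.
Variables (R : comNzRingType) (E : injective_resolution (R^o : lmodType R)).
Local Notation d := (res_d E _).

Local Notation powers k w := ([seq x ^+ k | x <- w]).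

(* Says that Ext^n(R/(a), R) is R/(a), generated by [xi], and that the higher
   Ext groups vanish; true for a regular sequence a of length n. *)
Definition ext_generator (a : seq R) n (xi : res_obj E n) :=
  [/\ kill a xi /\ d xi = 0,
      forall r, kill_coboundary a (r *: xi) -> in_span a r,
      forall x : res_obj E n, kill a x -> d x = 0 ->
        exists r, kill_coboundary a (x - r *: xi) &
      forall m (x : res_obj E m), (n < m)%N -> kill a x -> d x = 0 ->
        kill_coboundary a x].

(** The short exact sequence of multiplication by b on R/(a) identifies Ext^(n+1)(R/(b, a), R) with
    Ext^n(R/(a), R) modulo b; [d e] is the image of [xi] under the connecting map. *)
Lemma ext_generator_cons b (a : seq R) n (xi e : res_obj E n) :
  (forall r, in_span a (b * r) -> in_span a r) -> ext_generator a xi ->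
  kill a e -> b *: e = xi -> ext_generator (b :: a) (d e).
Proof.
move=> breg [[axi dxi] Q1 Q2 Q3] ae exi.
have kS m := kill_submodule a (res_obj E m).
have cS := kill_coboundary_submodule E a n.
split.
- split; last exact: res_d_d.
  apply/kill_cons; split; last exact: kill_linear.
  by rewrite -linearZ exi.
(* If r (d e) = d f, then r e - f is a cocycle, so it is r' xi up to a coboundary. Multiplication by
   b shows that (r - b r') xi is a coboundary. *)
- move=> r [f /kill_cons[bf af] fr].
  have [||r' hr'] := Q2 (r *: e - f).
  + have [_ hD hZ] := kS n; apply: hD; first exact: hZ.
    by rewrite -scaleN1r; apply: hZ.
  + by rewrite linearB linearZ /= fr subrr.
  have [_ _ /(_ b _ hr')] := cS.
  rewrite !scalerBr bf subr0 scalerA mulrC -scalerA exi scalerA -scalerBl.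
  by move=> /Q1 h; exists r', (r - b * r'); split=> //; ring.
(* Write x = d y. Then b y = r xi + b z with a coboundary z, so y - r e - z is killed by b and has
   differential x - r (d e). *)
- move=> x /kill_cons[bx ax] dx.
  have [y ay yx] := Q3 _ x (ltnSn _) ax dx.
  have [||r hr] := Q2 (b *: y).
  + by have [_ _ hZ] := kS n; apply: hZ.
  + by rewrite linearZ /= yx.
  have [z hz zE] := kill_coboundary_divide breg hr.
  exists r; exists (y - r *: e - z).
    apply/kill_cons; split.
      by rewrite !scalerBr zE scalerA mulrC -scalerA exi subrr.
    have [_ hD hZ] := kS n.
    have hN (u : res_obj E n) : kill a u -> kill a (- u).
      by rewrite -scaleN1r; apply: hZ.
    apply: (hD); last exact/hN/kill_coboundary_kill/hz.
    by apply: hD => //; exact/hN/hZ.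
  by rewrite !linearB linearZ /= (kill_coboundary_cocycle hz) subr0 yx.
- move=> [//|m] x /= an /kill_cons[bx ax] dx.
  have [y ay yx] := Q3 _ x (ltnW an) ax dx.
  have [_ hD hZ] := kS m.
  have hy : kill_coboundary a (b *: y).
    by apply: Q3 => //; [apply: hZ|rewrite linearZ /= yx].
  have [z hz zE] := kill_coboundary_divide breg hy.
  exists (y - z); last by rewrite linearB /= (kill_coboundary_cocycle hz) subr0.
  apply/kill_cons; split; first by rewrite scalerBr zE subrr.
  apply: hD => //; rewrite -scaleN1r; apply: hZ; exact: kill_coboundary_kill hz.
Qed.

Lemma ext_generator_nil : ext_generator [::] (res_aug E (1 : R^o)).
Proof.
split.
- by split=> [//|]; apply/res_exact0; exists 1.
- move=> r /=; rewrite -linearZ => h; apply: (res_aug_injective (i := E)).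
  by rewrite linear0 -h; congr (res_aug E _); rewrite /GRing.scale /= mulr1.
- move=> x _ /res_exact0[r <-]; exists r => /=.
  by rewrite -linearZ -linearB /GRing.scale /= mulr1 subrr linear0.
- by move=> [//|n] x _ _ /res_exactS[y yx]; exists y.
Qed.

(* [xi] and [xi'] stand for the classes of 1 / p and 1 / p ^ k in the Cech
   complex of w, where p is the product of w. *)
Lemma koszul_class (w : seq R) : regular w ->
  (forall k, (0 < k)%N -> regular (powers k w)) ->
  exists xi : res_obj E (size w), [/\ kill w xi, d xi = 0 &
    forall k, (0 < k)%N -> exists2 xi' : res_obj E (size w),
      ext_generator (powers k w) xi' &
      kill_coboundary (powers k w) ((\prod_(x <- w) x) ^+ k.-1 *: xi' - xi)].
Proof.
elim: w => [|b w IH] /=.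
  move=> _ _; exists (res_aug E (1 : R^o)).
  split=> [//||k _]; first by apply/res_exact0; exists 1.
  exists (res_aug E (1 : R^o)); first exact: ext_generator_nil.
  by rewrite big_nil expr1n scale1r /= subrr.
move=> [wreg breg] preg.
have [|xi [wxi dxi hxi]] := IH wreg; first by move=> k /preg[].
have [e exi we] := kill_divide (@res_obj_injective _ _ E _) breg wxi.
exists (d e); split=> [||k k0].
- apply/kill_cons; split; last exact: kill_linear.
  by rewrite -linearZ exi.
- exact: res_d_d.
have [xi' gxi' hxi'] := hxi k k0; have [_ bkreg] := preg k k0.
have [[axi' _] _ _ _] := gxi'.
have [e' exi' we'] := kill_divide (@res_obj_injective _ _ E _) bkreg axi'.
exists (d e'); first exact: ext_generator_cons gxi' we' exi'.
have [z hz zE] := kill_coboundary_divide bkreg hxi'.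
set p := (\prod_(x <- w) x) ^+ k.-1 in zE *.
(* As b^k e' = xi', b^k z = p xi' - xi and b e = xi, this is killed by b; as z is a cocycle, its
   differential is the required difference. *)
exists (b ^+ k.-1 *: (p *: e' - z) - e); last first.
  rewrite linearB linearZ linearB linearZ /= (kill_coboundary_cocycle hz) subr0.
  by rewrite scalerA big_cons exprMn.
have bk : b ^+ k = b * b ^+ k.-1 by rewrite -exprS prednK.
apply/kill_cons; split.
  rewrite bk mulrC -scalerA; have -> : b *: (b ^+ k.-1 *: (p *: e' - z) - e) = 0.
    rewrite scalerBr scalerA -bk exi scalerBr zE scalerA mulrC -scalerA exi'.
    by rewrite opprB addrCA subrr addr0 subrr.
  by rewrite scaler0.
have [_ hD hZ] := kill_submodule (powers k w) (res_obj E (size w)).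
apply: (hD).
  apply: (hZ); apply: (hD); first exact: hZ.
  by rewrite -scaleN1r; apply: hZ; apply: kill_coboundary_kill.
rewrite -scaleN1r; apply: hZ => _ /mapP[x xw ->].
by rewrite -(prednK k0) exprSr -scalerA we ?scaler0.
Qed.

Lemma tors_kill_powers (w : seq R) (N : lmodType R) (x : N) :
  tors w x -> exists2 k, (0 < k)%N & kill (powers k w) x.
Proof.
elim: w => [|b w IH]; first by move=> _; exists 1%N.
move=> /tors_cons[[m hm] /IH[k k0 hk]]; exists (m + k)%N; first lia.
move=> y; rewrite /= inE => /predU1P[->|/mapP[z zw ->]].
  by rewrite addnC exprD -scalerA hm scaler0.
by rewrite exprD -scalerA hk ?scaler0 //; apply/mapP; exists z.
Qed.

(** Let p be the product of w. If [xi] is a torsion coboundary, it is a coboundary of Hom(R/(w^k),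
    E) for some k, and so is p^(k-1) xi'. Since [xi'] generates Ext(R/(w^k), R), which is R/(w^k),
    this puts p^(k-1) into (w^k). *)
Lemma top_cohomology (w : seq R) : regular w ->
  (forall k, (0 < k)%N -> regular (powers k w)) ->
  (forall k, (0 < k)%N -> ~ in_span (powers k w) ((\prod_(x <- w) x) ^+ k.-1)) ->
  forall I : R -> Prop,
  (forall (N : lmodType R) (x : N), torsion I x <-> tors w x) ->
  exists2 x : res_obj E (size w), torsion_cocycle I x & ~ torsion_coboundary I x.
Proof.
move=> wreg preg pspan I Iw; have [xi [wxi dxi hxi]] := koszul_class wreg preg.
exists xi.
  by split=> //; apply/Iw => y yw; exists 1%N; rewrite expr1 wxi.
move=> cob; have [k k0 hk] : exists2 k, (0 < k)%N & kill_coboundary (powers k w) xi.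
  move: xi cob {wxi dxi hxi}; case: (size w) => [|s] xi /=; first by exists 1%N.
  by move=> [y /Iw/tors_kill_powers[k k0 yk] yx]; exists k => //; exists y.
have [xi' [_ Q1 _ _] h] := hxi k k0.
apply: (pspan k k0); apply: Q1.
have [_ hD _] := kill_coboundary_submodule E (powers k w) (size w).
by have := hD _ _ h hk; rewrite subrK.
Qed.

End TopCohomology.

(** * The Mayer-Vietoris connecting map *)

Section MayerVietoris.
Variables (R : comNzRingType) (M : lmodType R) (E : injective_resolution M).

(** Up to radical, I is the intersection of (a) and (b), and [Im] is their sum. Both lists are too
    short for cohomology in degree n + 2, so x = d y1 = d y2 with y1 torsion for [a] and y2 torsion
    for [b]; the connecting map takes the class of y1 - y2 to that of x. *)
Lemma mayer_vietoris (I Im : R -> Prop) (a b c : seq R) n :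
  noetherian R -> (size a < n.+2)%N -> (size b < n.+2)%N ->
  (forall (N : lmodType R) (x : N), torsion Im x <-> tors a x /\ tors b x) ->
  (forall (N : lmodType R) (x : N), torsion I x <-> tors c x) ->
  (forall y, y \in c -> radical (in_span a) y /\ radical (in_span b) y) ->
  (forall u v, u \in a -> v \in b -> radical (in_span c) (u * v)) ->
  (exists2 x : res_obj E n.+2, torsion_cocycle Im x & ~ torsion_coboundary Im x) ->
  exists2 x : res_obj E n.+1, torsion_cocycle I x & ~ torsion_coboundary I x.
Proof.
move=> noethR an bn ImP Ic cP abP [x [/ImP[ax bx] dx] hx].
have [y1 ay1 yx1] := tors_acyclic noethR an ax dx.
have [y2 by2 yx2] := tors_acyclic noethR bn bx dx.
exists (y1 - y2).
  split; last by rewrite linearB /= yx1 yx2 subrr.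
  by apply/Ic/torsB; [apply: tors_radical ay1|apply: tors_radical by2] => y /cP[].
move=> [z /Ic cz zy].
have [|z1 [z2 [zE az1 bz2]]] :=
    @tors_split _ _ (@res_obj_injective _ _ E n) noethR a b z.
  move=> u v ua vb; have [//||k hk] := @tors_radical R c [:: u * v] _ z _ cz (u * v).
  - by move=> y; rewrite inE => /eqP ->; apply: abP.
  - exact: mem_head.
  - by exists k.
(* If y1 - y2 = d (z1 + z2), then y1 - d z1 = y2 + d z2 is torsion for both [a] and [b], and its
   differential is x. *)
apply: hx; exists (y1 - res_d E n z1); last by rewrite linearB /= res_d_d subr0.
apply/ImP; split; first by apply: torsB => //; apply: tors_linear.
have -> : y1 - res_d E n z1 = y2 + res_d E n z2.
  apply/eqP; rewrite subr_eq -addrA -linearD [z2 + _]addrC -zE zy /=.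
  by rewrite addrC subrK.
have [_ hD _] := tors_submodule b (res_obj E n.+1).
by apply: hD => //; apply: tors_linear.
Qed.

End MayerVietoris.

(** * Polynomial rings *)

Section Dickson.

(** Points are functions on nat of which only the first n values count, so that the induction can
    fix the last coordinate t and pass to the slice [S t]. The diagonal chain [S k k] settles all
    slices with t >= k0, and the induction hypothesis each of the finitely many others. *)
Lemma dickson n (U : nat -> (nat -> nat) -> Prop) :
  (forall k v w, U k v -> (forall i, (i < n)%N -> (v i <= w i)%N) -> U k w) ->
  (forall k v, U k v -> U k.+1 v) ->
  exists k0, forall k v, U k v -> U k0 v.
Proof.
elim: n => [|n IH] in U * => Uup UU.
  have [[k [v Ukv]]|hU] := pselect (exists k v, U k v).
    by exists k => k' v' _; apply: Uup Ukv _.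
  by exists 0%N => k v Ukv; case: hU; exists k, v.
have Umono k l v : (k <= l)%N -> U k v -> U l v.
  move=> kl Ukv; rewrite -(subnK kl); elim: (l - k)%N => [//|j]; exact: UU.
pose S t k v := U k (fun i => if i == n then t else v i).
have Sup t k v w : S t k v -> (forall i, (i < n)%N -> (v i <= w i)%N) -> S t k w.
  move=> h vw; apply: Uup h _ => i; case: eqP => // ni ln; apply: vw; lia.
have St s t k v : (s <= t)%N -> S s k v -> S t k v.
  by move=> st h; apply: Uup h _ => i _; case: eqP.
have [k0 hk0] : exists k0, forall k v, S k k v -> S k0 k0 v.
  apply: (IH (fun k => S k k)) => [k|k v h]; first exact: Sup.
  by apply: UU; apply: St h.
have [K hK] : exists K, forall t k v, (t < k0)%N -> S t k v -> S t K v.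
  elim: {hk0}k0 => [|k0 [K hK]]; first by exists 0%N.
  have [L hL] : exists L, forall k v, S k0 k v -> S k0 L v.
    by apply: IH => [k|k v]; [exact: Sup|exact: UU].
  exists (maxn K L) => t k v; rewrite ltnS leq_eqVlt => /predU1P[->|tk].
    by move=> /hL; apply: Umono; rewrite leq_maxr.
  by move=> /(hK _ _ _ tk); apply: Umono; rewrite leq_maxl.
exists (maxn K k0) => k v Ukv.
have : S (v n) k v by apply: Uup Ukv _ => i _; case: eqP => [->|].
suff h : S (v n) k v -> S (v n) (maxn K k0) v.
  by move=> /h h'; apply: Uup h' _ => i _; case: eqP => [->|].
have [vk|kv] := ltnP (v n) k0.
  by move=> /(hK _ _ _ vk); apply: Umono; rewrite leq_maxl.
move=> h; apply: (Umono k0); first by rewrite leq_maxr.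
(* Raising both indices of the slice to the maximum of [v n] and k leads to the diagonal chain. *)
apply: (St k0) => //; apply: (hk0 (maxn (v n) k)).
apply: (Umono k); first by rewrite leq_maxr.
by apply: St h; rewrite leq_maxl.
Qed.

End Dickson.

Section MPoly.
Variables (K : fieldType) (n : nat).
Local Notation R := {mpoly K[n]}.

(** By Dickson's lemma the sets of exponents above the leading ones become stable. From then on,
    subtracting a multiple of an element of [J k0] lowers the leading monomial. *)
Lemma mpoly_noetherian : noetherian R.
Proof.
move=> J Jid Jinc.
have Jmono k l p : (k <= l)%N -> J k p -> J l p.
  move=> kl Jkp; rewrite -(subnK kl); elim: (l - k)%N => [//|j]; exact: Jinc.
pose U k (v : nat -> nat) := exists f : R,
  [/\ J k f, f != 0 & forall i : 'I_n, (mlead f i <= v i)%N].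
have [k0 hk0] : exists k0, forall k v, U k v -> U k0 v.
  apply: (@dickson n) => [k v w [f [Jf f0 fv]] vw|k v [f [Jf f0 fv]]].
    by exists f; split=> // i; apply: leq_trans (fv i) (vw i (ltn_ord i)).
  by exists f; split=> //; apply: Jinc.
suff h k f : (k0 <= k)%N -> J k f -> J k0 f.
  exists k0 => k f Jkf; apply: (h (maxn k0 k)); rewrite ?leq_maxl //.
  by apply: Jmono Jkf; rewrite leq_maxr.
move=> kk; elim/mleadrect: f => f IH Jf.
have [->|f0] := eqVneq f 0; first by case: (Jid k0).
(* The exponent vector of the leading monomial is extended by 0 to all of nat. *)
have [g [Jg g0 gv]] : U k0 (fun i => if insub i is Some j then mlead f j else 0%N).
  by apply: (hk0 k); exists f; split=> // i; rewrite valK.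
have gf : (mlead g <= mlead f)%MM.
  by apply/mnm_lepP => i; have := gv i; rewrite valK.
pose c := mleadc f / mleadc g.
have cg0 : mleadc g != 0 by rewrite mleadc_eq0.
have c0 : c != 0 by rewrite mulf_neq0 ?invr_eq0 ?mleadc_eq0.
pose q : R := c *: 'X_[mlead f - mlead g].
have q0 : q != 0.
  by rewrite -msupp_eq0 msuppMCX.
have lq : mlead q = (mlead f - mlead g)%MM.
  by rewrite mleadZ_proper mleadXm // mcoeffX eqxx mulr1.
have lqg : mlead (q * g) = mlead f by rewrite mleadM // lq submK.
have [J0 JD JM] := Jid k0; have [_ JkD _] := Jid k.
have Jqg : J k0 (q * g) by apply: JM.
rewrite -[f](subrK (q * g)); apply: JD => //.
have [->//|h0] := eqVneq (f - q * g) 0.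
apply: IH; last by apply: JkD => //; apply: ideal_opp => //; apply: Jmono Jqg.
rewrite lt_neqAle; apply/andP; split; last first.
  by have := mleadB_le f (q * g); rewrite lqg joinxx.
apply: contraNneq h0 => e; rewrite -mleadc_eq0 e mcoeffB -{2}lqg mleadM // mleadcM.
by rewrite lq mcoeffZ mcoeffX eqxx mulr1 /c divfK // subrr.
Qed.

Lemma span_powers (s : seq 'I_n) k (p : R) :
  in_span [seq x ^+ k | x <- [seq 'X_i | i <- s]] p <->
  forall m, m \in msupp p -> exists2 i, i \in s & (k <= m i)%N.
Proof.
split.
  pose J (p : R) := forall m, m \in msupp p -> exists2 i, i \in s & (k <= m i)%N.
  apply: (@in_span_min _ _ J) => [|_ /mapP[_ /mapP[i si ->] ->] m]; last first.
    rewrite mpolyXn msuppX inE => /eqP ->; exists i => //.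
    by rewrite mulmnE mnm1E eqxx mul1n.
  split=> [m|x y Jx Jy m /msuppD_le|x y Jy m /msuppM_le].
  - by rewrite msupp0.
  - by rewrite mem_cat => /orP[/Jx|/Jy].
  - move=> /allpairsP[[m1 m2] /= [_ /Jy[i si ki] ->]]; exists i => //.
    by rewrite mnmDE (leq_trans ki) ?leq_addl.
move=> hp; rewrite [p]mpolyE.
have [J0 JD JM] := in_span_ideal [seq x ^+ k | x <- [seq 'X_i | i <- s] : seq R].
rewrite big_seq; apply: big_ind => // m /hp[i si ki].
have im : (U_(i) *+ k <= m)%MM.
  apply/mnm_lepP => j; rewrite mulmnE mnm1E.
  by case: eqP => [<-|]; rewrite ?mul1n ?mul0n.
rewrite -(submK im) mpolyXD -mul_mpolyC mulrA; apply: JM; apply: in_span_mem.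
by rewrite -mpolyXn; apply/mapP; exists 'X_i => //; apply: map_f.
Qed.

(** Multiplication by a power of ['X_i] changes only the exponent at i, which [span_powers] does not
    test for the remaining variables. *)
Lemma regular_powers (s : seq 'I_n) k : uniq s ->
  regular ([seq x ^+ k | x <- [seq 'X_i | i <- s]] : seq R).
Proof.
elim: s => [//|i s IH] /= /andP[si /IH ?]; split=> // p.
move=> /span_powers hp; apply/span_powers => m pm.
have [|j sj] := hp (U_(i) *+ k + m)%MM.
  by rewrite mcoeff_msupp mpolyXn mulrC mcoeffMX -mcoeff_msupp.
rewrite mnmDE mulmnE mnm1E; case: eqP => [ij|_]; last by exists j.
by rewrite ij sj in si.
Qed.

Lemma regular_vars (s : seq 'I_n) : uniq s -> regular ([seq 'X_i | i <- s] : seq R).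
Proof.
move=> /(regular_powers 1); rewrite (@eq_map _ _ _ id) ?map_id //.
Qed.

Lemma prod_powers_not_in_span (s : seq 'I_n) k : uniq s -> (0 < k)%N ->
  ~ in_span ([seq x ^+ k | x <- [seq 'X_i | i <- s]] : seq R)
      ((\prod_(x <- [seq 'X_i | i <- s]) x) ^+ k.-1).
Proof.
move=> us k0 /span_powers.
rewrite big_map -(big_map (fun i => U_(i)%MM) xpredT (fun m => 'X_[m])).
rewrite mpolyX_prod mpolyXn.
rewrite msuppX => /(_ _ (mem_head _ _))[i si].
rewrite mulmnE mnm_sumE big_map (bigD1_seq i) //= mnm1E eqxx big1 => [|j ji].
  by rewrite addn0 mul1n leqNgt prednK // leqnn.
by rewrite mnm1E (negPf ji).
Qed.

End MPoly.

(** * Generators up to radical of a colored monomial ideal *)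

Section SchmittVogel.
Variables (R : comNzRingType) (T : finType) (P : pred T) (g : T -> R).
Variables (lev : T -> nat) (t : nat).

Definition level_sums : seq R :=
  mkseq (fun s => \sum_(p | P p && (lev p == s)) g p) t.

(** In the product of g p with the sum of its level, every term but (g p)^2 is a multiple of an
    element of lower level, which is in the radical by induction. *)
Lemma schmitt_vogel :
  (forall p, P p -> (lev p < t)%N) ->
  (forall p q, P p -> P q -> p != q -> lev p = lev q ->
     exists r c, [/\ P r, (lev r < lev p)%N & g p * g q = c * g r]) ->
  forall p, P p -> radical (in_span level_sums) (g p).
Proof.
move=> levt hP p; have [n] := ubnP (lev p); elim: n p => [//|n IH] p pn Pp.
set I := in_span level_sums; have hI : is_ideal I by apply: in_span_ideal.
have [r0 rD rM] := radical_ideal hI.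
apply: (@radicalX _ _ _ 2); rewrite expr2.
have : radical I (g p * \sum_(q | P q && (lev q == lev p)) g q).
  apply: rM; apply/radical_sub/in_span_mem.
  by apply/mapP; exists (lev p); rewrite // mem_iota levt.
rewrite (bigD1 p) ?Pp //= mulrDr => h.
rewrite -[g p * g p](addrK (g p * \sum_(q | (P q && (lev q == lev p)) && (q != p)) g q)).
apply: rD => //; apply: ideal_opp; first exact: radical_ideal.
rewrite mulr_sumr; apply: ideal_sum; first exact: radical_ideal.
move=> q /andP[/andP[Pq /eqP lq] qp].
have [|r [c [Pr lr ->]]] := hP p q Pp Pq _ (esym lq); first by rewrite eq_sym.
by apply: rM; apply: IH => //; apply: leq_trans lr _.
Qed.

End SchmittVogel.

Section ColoredIdeal.
Variables (R : comNzRingType) (N : nat) (X : 'I_N -> R).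
Implicit Types (live : pred 'I_N) (col : 'I_N -> nat).

Definition dead_gens live : seq R := [seq X u | u <- enum [predC live]].

Definition edge live col (p : 'I_N * 'I_N) :=
  [&& live p.1, live p.2, (p.1 < p.2)%N & col p.1 != col p.2].

(* Up to radical these generate the intersection, over the colors c, of the
   ideals (X u : u is dead or col u != c). *)
Definition colored_gens live col : seq R :=
  dead_gens live ++ [seq X p.1 * X p.2 | p <- enum (edge live col)].

Lemma dead_gensP live u : ~~ live u -> X u \in dead_gens live.
Proof. by move=> du; apply: map_f; rewrite mem_enum. Qed.

Lemma colored_gens_dead live col u : ~~ live u -> X u \in colored_gens live col.
Proof. by move=> du; rewrite mem_cat dead_gensP. Qed.

Lemma colored_gens_edge live col u v : col u != col v ->
  in_span (colored_gens live col) (X u * X v).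
Proof.
have [_ _ hM] := in_span_ideal (colored_gens live col).
have [lu|du] := boolP (live u); last first.
  by move=> _; rewrite mulrC; apply/hM/in_span_mem/colored_gens_dead.
have [lv|dv] := boolP (live v); last first.
  by move=> _; apply/hM/in_span_mem/colored_gens_dead.
move=> uv; wlog lt_uv : u v lu lv uv / (u < v)%N.
  move=> IH; have [/IH|vu|/val_inj e] := ltngtP u v; first by apply.
    by rewrite mulrC; apply: IH => //; rewrite eq_sym.
  by rewrite e eqxx in uv.
apply: in_span_mem; rewrite mem_cat; apply/orP; right.
by apply/mapP; exists (u, v) => //; rewrite mem_enum unfold_in /edge /= lu lv lt_uv.
Qed.

Lemma colored_gensP live col y : y \in colored_gens live col ->
  (exists2 u, ~~ live u & y = X u) \/
  (exists u v, [/\ live u, live v, col u != col v & y = X u * X v]).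
Proof.
rewrite mem_cat => /orP[/mapP[u]|/mapP[[u v]]]; rewrite mem_enum unfold_in.
  by left; exists u.
by move=> /and4P[/= lu lv _ uv] ->; right; exists u, v.
Qed.

(* For two live variables u < v of different colors the level of X u * X v is
   rho u + rho v - S (col u), where rho is the rank among the live variables
   and S c is the number of live variables of color at most c.  The dead
   variables come after these levels, each on its own. *)
Lemma colored_gens_up_to_radical live col :
  (forall u v, live u -> live v -> (u <= v)%N -> (col u <= col v)%N) ->
  (exists u, live u) ->
  exists a : seq R, [/\ size a = N.-1,
    forall y, y \in a -> in_span (colored_gens live col) y &
    forall y, y \in colored_gens live col -> radical (in_span a) y].
Proof.
move=> colm [u0 lu0].
pose n := #|[pred v | live v]|.
pose rho u := #|[pred v : 'I_N | live v && (v < u)%N]|.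
pose S c := #|[pred v : 'I_N | live v && (col v <= c)%N]|.
pose delta u := #|[pred v : 'I_N | ~~ live v && (v < u)%N]|.
(* For an edge (u, v) this bound and the next give rho u < S (col u) <= rho v. So the subtraction in
   the level does not truncate, and the level is below [n.-1]. *)
have rhoS u : live u -> (rho u < S (col u))%N.
  move=> lu; apply: proper_card; apply/properP; split.
    by apply/subsetP => v; rewrite !inE => /andP[lv vu]; rewrite lv colm // ltnW.
  by exists u; rewrite !inE ?lu ?leqnn // ltnn.
have Srho u c : live u -> (c < col u)%N -> (S c <= rho u)%N.
  move=> lu cu; apply: subset_leq_card; apply/subsetP => v.
  rewrite !inE => /andP[lv vc]; rewrite lv /= ltnNge; apply/negP => uv.
  by have := colm u v lu lv uv; lia.
have rho_lt u v : live u -> (u < v)%N -> (rho u < rho v)%N.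
  move=> lu uv; apply: proper_card; apply/properP; split.
    by apply/subsetP => w; rewrite !inE => /andP[-> wu]; apply: ltn_trans uv.
  by exists u; rewrite !inE lu ?uv // ltnn.
have rho_n u : live u -> (rho u < n)%N.
  move=> lu; apply: proper_card; apply/properP; split.
    by apply/subsetP => w; rewrite !inE => /andP[].
  by exists u; rewrite !inE lu ?ltnn.
have delta_lt u v : ~~ live u -> (u < v)%N -> (delta u < delta v)%N.
  move=> lu uv; apply: proper_card; apply/properP; split.
    by apply/subsetP => w; rewrite !inE => /andP[-> wu]; apply: ltn_trans uv.
  by exists u; rewrite !inE lu ?uv // ltnn.
have delta_n u : ~~ live u -> (delta u < N - n)%N.
  move=> lu; have -> : (N - n = #|[predC live]|)%N.
    have := cardC live; rewrite card_ord => e; rewrite -[in LHS]e.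
    rewrite (_ : n = #|live|) ?addKn //; exact: eq_card.
  apply: proper_card; apply/properP; split.
    by apply/subsetP => w; rewrite !inE => /andP[].
  by exists u; rewrite !inE ?lu ?ltnn.
have n0 : (0 < n)%N by apply/card_gt0P; exists u0.
have nN : (n <= N)%N by rewrite -[N in (_ <= N)%N]card_ord max_card.
(* A diagonal pair (u, u) stands for the dead variable [X u]. *)
pose P (p : 'I_N * 'I_N) := (p.1 == p.2) && ~~ live p.1 || edge live col p.
pose g (p : 'I_N * 'I_N) := if p.1 == p.2 then X p.1 else X p.1 * X p.2.
pose lev (p : 'I_N * 'I_N) := if p.1 == p.2 then (n.-1 + delta p.1)%N
  else (rho p.1 + rho p.2 - S (col p.1))%N.
have edgeP u v : edge live col (u, v) ->
    [/\ live u, live v, (u < v)%N, (col u < col v)%N & (u == v) = false].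
  move=> /and4P[/= lu lv uv cuv]; split=> //; last first.
    by apply/negbTE; rewrite neq_ltn uv.
  by rewrite ltn_neqAle cuv colm // ltnW.
have edgeI u v : live u -> live v -> (col u < col v)%N -> edge live col (u, v).
  move=> lu lv cuv; rewrite /edge /= lu lv neq_ltn cuv andbT /= ltnNge.
  by apply/negP => vu; have := colm v u lv lu vu; lia.
have levE u v : edge live col (u, v) ->
    lev (u, v) = (rho u + rho v - S (col u))%N /\ (lev (u, v) < n.-1)%N.
  move=> /edgeP[lu lv _ cuv uv]; rewrite /lev /= uv; split=> //.
  by have := rhoS u lu; have := Srho v _ lv cuv; have := rho_n v lv; lia.
have gE u v : edge live col (u, v) -> g (u, v) = X u * X v.
  by move=> /edgeP[_ _ _ _ uv]; rewrite /g /= uv.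
have PE p : P p -> (exists2 u, p = (u, u) & ~~ live u) \/ edge live col p.
  case: p => u v; rewrite /P /= => /orP[/andP[/eqP <- du]|]; last by right.
  by left; exists u.
have levD u : lev (u, u) = (n.-1 + delta u)%N by rewrite /lev /= eqxx.
have edge_key u v u' v' : edge live col (u, v) -> edge live col (u', v') ->
    (col u < col u')%N || (col u == col u') && (u <= u')%N ->
    (u, v) != (u', v') -> lev (u, v) = lev (u', v') ->
    exists r c, [/\ P r, (lev r < lev (u, v))%N & g (u, v) * g (u', v') = c * g r].
  move=> e e'; rewrite !gE //.
  have [le _] := levE _ _ e; have [le' _] := levE _ _ e'.
  have [lu lv _ cuv uv] := edgeP _ _ e; have [lu' lv' _ cuv' uv'] := edgeP _ _ e'.
  have ru := rhoS u lu; have rv := Srho v _ lv cuv.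
  have ru' := rhoS u' lu'; have rv' := Srho v' _ lv' cuv'.
  move=> /orP[cc|/andP[/eqP cc uu]] ne hlev.
    (* The level of (u, u') is below rho u', and that of (u', v') is at least rho u'. *)
    have er := edgeI _ _ lu lu' cc; have [ler _] := levE _ _ er.
    exists (u, u'), (X v * X v'); split; first by rewrite /P er orbT.
      by have := Srho u' _ lu' cc; lia.
    by rewrite gE //; ring.
  have er : edge live col (u, v') by apply: edgeI => //; rewrite cc.
  have [ler _] := levE _ _ er.
  have uu' : (u < u')%N.
    rewrite ltn_neqAle uu andbT; apply: contraNneq ne => /val_inj euu.
    move: hlev; rewrite le le' -euu => hlev.
    have rvv : rho v = rho v' by rewrite -euu in rv'; lia.
    rewrite xpair_eqE eqxx /=; apply/eqP/val_inj => /=.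
    case: (ltngtP v v') => // vv.
      by have := rho_lt v v' lv vv; lia.
    by have := rho_lt v' v lv' vv; lia.
  (* The level of (u, v') is that of (u', v') with rho u' replaced by the smaller rho u, the colors
     of u and u' being equal. *)
  exists (u, v'), (X v * X u'); split; first by rewrite /P er orbT.
    have := rho_lt u u' lu uu'; rewrite -cc in le' rv' *.
    by rewrite ler le; lia.
  by rewrite gE //; ring.
have lev_lt p : P p -> (lev p < N.-1)%N.
  move=> /PE[[u -> du]|]; first by rewrite levD; have := delta_n u du; lia.
  by case: p => u v /levE[_ h]; apply: leq_trans h _; lia.
have key p q : P p -> P q -> p != q -> lev p = lev q ->
    exists r c, [/\ P r, (lev r < lev p)%N & g p * g q = c * g r].
  case: p q => u v [u' v'].
  move=> /PE[[w -> dw]|e] /PE[[w' -> dw']|e'] ne hlev.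
  - move: hlev ne; rewrite !levD => /addnI hd; have -> : w = w'; last by rewrite eqxx.
    apply/val_inj => /=; case: (ltngtP w w') => // ww.
      by have := delta_lt w w' dw ww; rewrite hd ltnn.
    by have := delta_lt w' w dw' ww; rewrite hd ltnn.
  - by have [_] := levE _ _ e'; rewrite -hlev levD; lia.
  - by have [_] := levE _ _ e; rewrite hlev levD; lia.
  - have [h|h] := boolP ((col u < col u')%N || (col u == col u') && (u <= u')%N).
      exact: edge_key.
    have h' : (col u' < col u)%N || (col u' == col u) && (u' <= u)%N.
      by move: h; case: (ltngtP (col u) (col u')) => //= _; rewrite -ltnNge => /ltnW.
    have [||r [c [Pr lr grE]]] := edge_key _ _ _ _ e' e h'; [by rewrite eq_sym|by []|].
    by exists r, c; rewrite mulrC hlev.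
have sv := schmitt_vogel lev_lt key.
exists (level_sums P g lev N.-1); split=> [|y|y]; first exact: size_mkseq.
  move=> /mapP[s _ ->]; apply: ideal_sum; first exact: in_span_ideal.
  move=> [u v] /andP[/PE[[w -> dw]|e] _].
    by rewrite /g /= eqxx; apply/in_span_mem/colored_gens_dead.
  rewrite gE //; apply: colored_gens_edge.
  by have [_ _ _ + _] := edgeP _ _ e; rewrite neq_ltn => ->.
rewrite mem_cat => /orP[/mapP[u]|/mapP[[u v]]]; rewrite mem_enum unfold_in.
  move=> du ->; have := sv (u, u); rewrite /P /g /= eqxx /=; apply.
  by move: du; rewrite /= => ->.
move=> e -> /=; rewrite -(gE _ _ e); apply: sv.
by rewrite /P; apply/orP; right.
Qed.

End ColoredIdeal.

(** * Cohomological dimension and arithmetical rank *)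

(** The list [a] bounds both numbers from above. Conversely, cohomology in degree [size a] forces
    that many members in every family that generates I up to radical. *)
Lemma cd_ara_of_generators (K : fieldType) n (I : {mpoly K[n]} -> Prop)
    (g a : seq {mpoly K[n]}) :
  is_ideal I -> (forall r, I r -> in_span g r) ->
  (forall y, y \in g -> radical I y) -> (forall y, y \in a -> in_span g y) ->
  (forall y, y \in g -> radical (in_span a) y) ->
  local_cohomology_neq0 I ({mpoly K[n]}^o : lmodType _) (size a) ->
  is_cd I (size a) /\ is_ara I (size a).
Proof.
move=> hI Ig gI ag ga nz.
have hrI := radical_ideal hI.
have Ia (N : lmodType {mpoly K[n]}) (x : N) : torsion I x <-> tors a x.
  rewrite (torsionP _ Ig gI); split; apply: tors_radical => // y /ag h.
  by exists 1%N; rewrite expr1.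
split; split=> //.
- move=> k [E [x [xc xb]]].
  exact: (local_cohomology_bound (@mpoly_noetherian K n) Ia xc xb).
- apply: generated_up_to_radical_seq => // [y /ag|x /Ig h].
    exact: in_span_min.
  exact: (in_span_min (radical_ideal (in_span_ideal a)) ga h).
- move=> t [f hf]; have [E [x [xc xb]]] := nz.
  have If := torsion_generators hI Ig gI hf.
  have := local_cohomology_bound (@mpoly_noetherian K n) If xc xb.
  by rewrite size_codom card_ord.
Qed.

Lemma top_cohomology_vars (K : fieldType) n (s : seq 'I_n) (I : {mpoly K[n]} -> Prop)
    (E : injective_resolution ({mpoly K[n]}^o : lmodType _)) :
  uniq s ->
  (forall (N : lmodType {mpoly K[n]}) (x : N),
     torsion I x <-> tors [seq 'X_i | i <- s] x) ->
  exists2 x : res_obj E (size s), torsion_cocycle I x & ~ torsion_coboundary I x.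
Proof.
move=> us Is; rewrite -(size_map (fun i => 'X_i : {mpoly K[n]}) s).
apply: top_cohomology Is => [|k _|k k0].
- exact: regular_vars.
- exact: regular_powers.
- exact: prod_powers_not_in_span.
Qed.

(** [a] cuts out the subspace of the color of [u0], and [b] the union of the other subspaces. They
    meet in the origin, whose ideal [Im] has nonzero cohomology in degree n. *)
Lemma colored_cohomology (K : fieldType) n (live : pred 'I_n) (col : 'I_n -> nat)
    (I : {mpoly K[n]} -> Prop)
    (E : injective_resolution ({mpoly K[n]}^o : lmodType _)) :
  let X (i : 'I_n) : {mpoly K[n]} := 'X_i in
  (forall u v, live u -> live v -> (u <= v)%N -> (col u <= col v)%N) ->
  (exists u v, [/\ live u, live v & col u != col v]) ->
  (forall (N : lmodType {mpoly K[n]}) (x : N),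
     torsion I x <-> tors (colored_gens X live col) x) ->
  exists2 x : res_obj E n.-1, torsion_cocycle I x & ~ torsion_coboundary I x.
Proof.
move=> X colm [u0 [v0 [lu0 lv0 uv0]]] Ic.
pose live1 u := live u && (col u == col u0).
pose live2 u := live u && (col u != col u0).
pose a := dead_gens X live1.
have [||b [bn bg gb]] := @colored_gens_up_to_radical _ _ X live2 col.
- by move=> u v /andP[lu _] /andP[lv _]; apply: colm.
- by exists v0; rewrite /live2 lv0 eq_sym.
have {}gb y : in_span (colored_gens X live2 col) y -> radical (in_span b) y.
  by apply: in_span_min => //; apply/radical_ideal/in_span_ideal.
pose Im := in_span [seq X i | i <- enum 'I_n].
have ImP (N : lmodType {mpoly K[n]}) (x : N) :
    torsion Im x <-> tors [seq X i | i <- enum 'I_n] x.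
  by apply: torsionP => // y /in_span_mem h; apply: radical_sub.
have n2 : (1 < n)%N.
  have : u0 != v0 by apply: contraNneq uv0 => ->.
  rewrite -(inj_eq val_inj) /= => h; have := ltn_ord u0; have := ltn_ord v0; lia.
have sa : (size a < n)%N.
  rewrite size_map -cardE; have := cardC live1; rewrite card_ord => e.
  suff : (0 < #|live1|)%N by rewrite -(ltn_add2r #|[predC live1]|) add0n e.
  by apply/card_gt0P; exists u0; rewrite unfold_in /live1 lu0 eqxx.
case: n => [//|[//|n]] in live col I E X colm u0 v0 lu0 lv0 uv0 Ic live1 live2
  a b bn bg gb Im ImP n2 sa *.
have dead1 u : col u != col u0 -> ~~ live1 u.
  by rewrite /live1 negb_and => ->; rewrite orbT.
have dead2 u : col u == col u0 -> ~~ live2 u.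
  by rewrite /live2 => ->; rewrite andbF.
have span_a y : y \in a -> radical (in_span a) y.
  by move=> h; apply/radical_sub/in_span_mem.
have [_ raD raM] := radical_ideal (in_span_ideal a).
have [_ rbD rbM] := radical_ideal (in_span_ideal b).
have Xa u : ~~ live1 u -> radical (in_span a) (X u).
  by move=> du; apply/span_a/dead_gensP.
have Xb u : ~~ live2 u -> radical (in_span b) (X u).
  by move=> du; apply/gb/in_span_mem/colored_gens_dead.
have dead u : ~~ live u -> ~~ live1 u /\ ~~ live2 u.
  by rewrite /live1 /live2 => /negbTE ->.
apply: (@mayer_vietoris _ _ E I Im a b (colored_gens X live col) n) => //.
- exact: mpoly_noetherian.
- by rewrite bn.
- move=> N x; rewrite ImP; split=> [h|[ax bx] _ /mapP[u _ ->]].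
    have Xin y : in_span [seq X i | i <- enum 'I_n.+2] y ->
        radical (in_span [seq X i | i <- enum 'I_n.+2]) y by exact: radical_sub.
    have Xu u : in_span [seq X i | i <- enum 'I_n.+2] (X u).
      by apply/in_span_mem/map_f; rewrite mem_enum.
    have [_ _ hM] := in_span_ideal [seq X i | i <- enum 'I_n.+2].
    split; apply: tors_radical h => y.
      by move=> /mapP[u _ ->]; apply: Xin.
    move=> /bg h; apply: Xin; apply: in_span_min h => [|z /colored_gensP].
      exact: in_span_ideal.
    by case=> [[u _ ->]|[u [v [_ _ _ ->]]]] //; apply: hM.
  have [uc|uc] := boolP (col u == col u0).
    have h := @tors_radical _ b [:: X u] N x _ bx; apply: h; last exact: mem_head.
    by move=> y; rewrite inE => /eqP ->; apply/Xb/dead2.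
  have h := @tors_radical _ a [:: X u] N x _ ax; apply: h; last exact: mem_head.
  by move=> y; rewrite inE => /eqP ->; apply/Xa/dead1.
- move=> y /colored_gensP[[u /dead[du1 du2] ->]|[u [v [lu lv uv ->]]]].
    by split; [apply: Xa|apply: Xb].
  have [uc|uc] := boolP (col u == col u0).
    split; last by rewrite mulrC; apply/rbM/Xb/dead2.
    by apply/raM/Xa/dead1; rewrite -(eqP uc) eq_sym.
  split; first by rewrite mulrC; apply/raM/Xa/dead1.
  have [vc|vc] := boolP (col v == col u0); first by apply/rbM/Xb/dead2.
  by apply/gb/colored_gens_edge.
- move=> _ v /mapP[u du ->] /bg vb.
  have du1 : ~~ live1 u by move: du; rewrite mem_enum.
  apply: radical_sub.
  have [c0 cD cM] := in_span_ideal (colored_gens X live col).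
  apply: (@in_span_min _ _ (fun v => in_span (colored_gens X live col) (X u * v))) vb.
    split=> [|x y|r x]; first by rewrite mulr0.
      by rewrite mulrDr; apply: cD.
    by rewrite mulrCA; apply: cM.
  have gX w : ~~ live w -> in_span (colored_gens X live col) (X w).
    by move=> dw; apply/in_span_mem/colored_gens_dead.
  have [lu|/gX h] := boolP (live u); last by move=> y _; rewrite mulrC; apply: cM.
  have uc : col u != col u0 by move: du1; rewrite /live1 lu.
  move=> y /colored_gensP[[w dw ->]|[w [w' [/andP[lw _] /andP[lw' _] ww ->]]]].
    have [lw|/gX h] := boolP (live w); last exact: cM.
    apply: colored_gens_edge; move: dw; rewrite /live2 lw /= negbK => /eqP ->.
    exact: uc.
  by apply/cM/colored_gens_edge.
- have := top_cohomology_vars E (enum_uniq _) ImP.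
  by rewrite size_enum_ord.
Qed.

(** * Jordan matrices *)

Lemma det2 (R : comNzRingType) (A : 'M[R]_2) :
  \det A = A ord0 ord0 * A ord_max ord_max - A ord0 ord_max * A ord_max ord0.
Proof.
rewrite (expand_det_row _ ord0) !big_ord_recl big_ord0 addr0 /cofactor !det_mx11 !mxE.
have e0 : lift ord0 0 = ord_max :> 'I_2 by apply/val_inj.
have e1 : lift ord_max 0 = ord0 :> 'I_2 by apply/val_inj.
have e2 : lift (lift ord0 ord0) 0 = ord0 :> 'I_2 by apply/val_inj.
have e3 : lift ord0 ord0 = ord_max :> 'I_2 by apply/val_inj.
by rewrite ?e0 ?e1 ?e2 ?e3 /= expr0 expr1 mul1r mulN1r mulrN.
Qed.

Section Minors.
Variables (R : comNzRingType) (n : nat) (A : 'M[R]_(2, n)).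

Definition minor u v := A ord0 u * A ord_max v - A ord0 v * A ord_max u.

Lemma minors_ideal_minor u v : minors_ideal 2 A (minor u v).
Proof.
have [I0 _ _] := ideal_gen_ideal (fun x => exists (f : 'I_2 -> 'I_2) (g : 'I_2 -> 'I_n),
    [/\ {homo f : i j / (i < j)%N}, {homo g : i j / (i < j)%N}
      & x = \det (mxsub f g A)]).
wlog uv : u v / (u < v)%N.
  move=> IH; have [/IH//|vu|/val_inj ->] := ltngtP u v; last by rewrite /minor subrr.
  by rewrite /minor -opprB; apply: ideal_opp (IH _ _ vu); apply: ideal_gen_ideal.
apply: ideal_gen_sub; exists id, (fun i => if i == ord0 then u else v).
split=> // [i j|]; last by rewrite det2 !mxE.
by case: i j => [[|[|i]] hi] // [[|[|j]] hj].
Qed.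

Lemma minors_ideal_min (J : R -> Prop) : is_ideal J ->
  (forall u v, J (minor u v)) -> forall x, minors_ideal 2 A x -> J x.
Proof.
move=> hJ h x; apply: ideal_gen_min => // _ [f [g [fh _ ->]]].
have f01 := fh ord0 ord_max (ltn0Sn _).
have -> : \det (mxsub f g A) = minor (g ord0) (g ord_max); last exact: h.
(* A strictly increasing map from ['I_2] to itself is the identity. *)
have f0 : f ord0 = ord0.
  by apply/val_inj => /=; have := ltn_ord (f ord_max); lia.
have f1 : f ord_max = ord_max.
  by apply/val_inj => /=; have := ltn_ord (f ord_max); move: f01; rewrite f0 /=; lia.
by rewrite det2 !mxE f0 f1.
Qed.

End Minors.

Section Jordan.
Variables (K : fieldType) (d : nat) (lambda : 'I_d -> K) (alpha : 'I_d -> nat).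
Variable m : forall j : 'I_d, 'I_(alpha j) -> nat.
Hypothesis lambda_inj : injective lambda.
Hypothesis m_ge1 : forall j (i : 'I_(alpha j)), (1 <= m i)%N.

Local Notation N := (num_vars m).
Local Notation R := {mpoly K[N]}.
Local Notation A := (jordan_matrix lambda m).
Local Notation X := (fun u : 'I_N => 'X_u : R).

(** The index of the variable [jvar], and at the same time of its column in the matrix. *)
Definition block_var (j : 'I_d) (i : 'I_(alpha j)) (h : 'I_(m i)) : 'I_N :=
  tagnat.Rank (p_ := fun j => \sum_(i < alpha j) m i) j
    (tagnat.Rank (p_ := fun i => m i) i h).

Definition eigen (u : 'I_N) : 'I_d :=
  tagnat.sig1 (p_ := fun j => \sum_(i < alpha j) m i) u.

(* The last variables are the coordinates on the eigenspaces of the Jordan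
   blocks, where the second row of the matrix is a multiple of the first. *)
Definition last_in_block : pred 'I_N := fun u =>
  let s := tagnat.sig (p_ := fun j => \sum_(i < alpha j) m i) u in
  let t := tagnat.sig (p_ := fun i => m i) (tagged s) in
  (tagged t).+1 == m (tag t).

Lemma block_var_surj u : exists j i h, u = @block_var j i h.
Proof.
exists _, _, (tagnat.sig2 (tagnat.sig2 (p_ := fun j => \sum_(i < alpha j) m i) u)).
by rewrite /block_var !tagnat.sig2K.
Qed.

Lemma eigen_block_var j i h : eigen (@block_var j i h) = j.
Proof. exact: tagnat.Rank1K. Qed.

Lemma last_block_var j i h : last_in_block (@block_var j i h) = (h.+1 == m i).
Proof.
by rewrite /last_in_block /block_var /tagnat.Rank tagnat.rankK /= tagnat.rankK.
Qed.

Lemma eigen_mono (u v : 'I_N) : (u <= v)%N -> (eigen u <= eigen v)%N.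
Proof. exact: tagnat.le_sig1. Qed.

Lemma jordan_entry r j i h :
  A r (@block_var j i h) = jordan_block (lambda j) (@jvar K _ _ m j i) r h.
Proof.
have -> : A r (block_var h) = submxrow (submxrow A j) i r h by rewrite !mxE.
by rewrite !mxrowK.
Qed.

Lemma jordan_row0 u : A ord0 u = X u.
Proof. by have [j [i [h ->]]] := block_var_surj u; rewrite jordan_entry mxE. Qed.

Lemma jordan_row1 j i h :
  A ord_max (@block_var j i h) =
    (if (0 < h)%N then X (block_var (ord_pred h)) else 0)
    + (lambda j)%:MP * X (block_var h).
Proof. by rewrite jordan_entry mxE /= mul_mpolyC. Qed.

Lemma val_ord_pred n (h : 'I_n) : (0 < h)%N -> ord_pred h = h.-1 :> nat.
Proof.
case: n h => [[]//|n] h h0; have hn := ltn_ord h; rewrite /=.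
have -> : ((h + n.+1).-1 = h.-1 + n.+1)%N by lia.
by rewrite modnDr modn_small //; lia.
Qed.

Lemma pred_not_last j (i : 'I_(alpha j)) (h : 'I_(m i)) :
  (0 < h)%N -> ~~ last_in_block (block_var (ord_pred h)).
Proof.
move=> h0; rewrite last_block_var val_ord_pred // prednK //.
by rewrite neq_ltn ltn_ord.
Qed.

(** The second row differs from the eigenvalue times the first only by the preceding variable of the
    block, which is never the last one. *)
Lemma jordan_row1_mod u : exists2 D,
  D = 0 \/ (exists2 w, ~~ last_in_block w & D = X w) &
  A ord_max u = D + (lambda (eigen u))%:MP * X u.
Proof.
have [j [i [h ->]]] := block_var_surj u; rewrite jordan_row1 eigen_block_var.
exists (if (0 < h)%N then X (block_var (ord_pred h)) else 0) => //.
case: ifP => h0; [right|by left].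
by exists (block_var (ord_pred h)) => //; apply: pred_not_last.
Qed.

Local Notation I := (minors_ideal 2 A).
Local Notation gens := (colored_gens X last_in_block eigen).

Lemma jordan_minors_sub r : I r -> in_span gens r.
Proof.
have [g0 gD gM] := in_span_ideal gens.
apply: minors_ideal_min => [|u v]; first exact: in_span_ideal.
have gX D : D = 0 \/ (exists2 w, ~~ last_in_block w & D = X w) -> in_span gens D.
  by case=> [->//|[w dw ->]]; apply/in_span_mem/colored_gens_dead.
rewrite /minor !jordan_row0.
have [Du /gX hu ->] := jordan_row1_mod u; have [Dv /gX hv ->] := jordan_row1_mod v.
have -> : X u * (Dv + (lambda (eigen v))%:MP * X v)
    - X v * (Du + (lambda (eigen u))%:MP * X u)
  = X u * Dv + (- X v) * Du
    + ((lambda (eigen v))%:MP - (lambda (eigen u))%:MP) * (X u * X v) by ring.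
apply: (gD); first by apply: gD; apply: gM.
have [->|uv] := eqVneq (eigen u) (eigen v); first by rewrite subrr mul0r.
exact/gM/colored_gens_edge.
Qed.

Lemma jordan_gens_radical y : y \in gens -> radical I y.
Proof.
have hI : is_ideal I by apply: ideal_gen_ideal.
have hrI := radical_ideal hI; have [r0 rD rM] := hrI.
have minI u v : radical I (minor A u v) by apply/radical_sub/minors_ideal_minor.
have dead u : ~~ last_in_block u -> radical I (X u).
  have [j [i [h ->]]] := block_var_surj u.
  have [n] := ubnP (nat_of_ord h); elim: n h => [//|n IH] h hn dh.
  have hm : (h.+1 < m i)%N.
    by rewrite ltn_neqAle ltn_ord andbT -last_block_var.
  (* With X the variable at h and Y the next one, the minor is X^2 - Y D, where D is 0 or the
     variable before X and lies in the radical by induction. *)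
  have := minI (block_var h) (block_var (Ordinal hm)).
  rewrite /minor !jordan_row0 !jordan_row1 /=.
  have -> : block_var (ord_pred (Ordinal hm)) = block_var h.
    by congr block_var; apply/val_inj; apply: (@val_ord_pred _ (Ordinal hm)).
  set D := (if _ then _ else _); set Y := 'X_(block_var (Ordinal hm)) => hmin.
  have rDD : radical I D.
    rewrite /D; case: ifP => // h0; apply: IH; last exact: pred_not_last.
    by move: hn; rewrite val_ord_pred // -{1}(prednK h0).
  apply: (@radicalX _ _ _ 2).
  have := rD _ _ hmin (rM Y _ rDD); congr (radical _ _); ring.
have deadD D : D = 0 \/ (exists2 w, ~~ last_in_block w & D = X w) -> radical I D.
  by case=> [->//|[w /dead h ->]].
move=> /colored_gensP[[u /dead h -> //]|[u [v [_ _ uv ->]]]].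
have := minI u v; rewrite /minor !jordan_row0.
have [Du /deadD hu ->] := jordan_row1_mod u.
have [Dv /deadD hv ->] := jordan_row1_mod v => hmin.
pose c := lambda (eigen v) - lambda (eigen u).
have c0 : c != 0.
  by rewrite subr_eq0; apply: contraNneq uv => /lambda_inj ->.
have := rM (c^-1)%:MP _ (rD _ _ hmin (rD _ _ (rM (X v) _ hu) (rM (- X u) _ hv))).
congr (radical _ _).
transitivity ((c^-1)%:MP * (c%:MP * (X u * X v))); first by rewrite /c mpolyCB; ring.
by rewrite !mul_mpolyC scalerA mulVf // scale1r.
Qed.

Definition last_var (p : {j : 'I_d & 'I_(alpha j)}) : 'I_N :=
  @block_var (tag p) (tagged p) (Ordinal (etrans (ltn_predL _) (m_ge1 (tagged p)))).

Lemma last_var_last p : last_in_block (last_var p).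
Proof. by rewrite last_block_var /= prednK. Qed.

Lemma card_last_in_block : #|last_in_block| = num_blocks alpha.
Proof.
rewrite /num_blocks -tagnat.card.
have inj : injective last_var.
  case=> [j i] [j' i'] /(congr1 val)/eqP /=.
  rewrite [_ == _]tagnat.eq_Rank => /andP[/eqP e].
  case: _ / e in i' *; rewrite [_ == _]tagnat.eq_Rank => /andP[/eqP e _].
  by rewrite e.
rewrite -(card_codom inj); apply: eq_card => u.
apply/idP/codomP => [hu|[p ->]]; last first.
  exact: last_var_last.
have [j [i [h uE]]] := block_var_surj u; exists (Tagged (fun j => 'I_(alpha j)) i).
rewrite uE; congr block_var; apply/val_inj => /=.
move: hu; rewrite uE -[_ \in _]/(last_in_block _) last_block_var.
by move=> /eqP/(congr1 predn).
Qed.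

End Jordan.

Theorem theorem4p1 (K : fieldType) (d : nat) (lambda : 'I_d -> K)
    (alpha : 'I_d -> nat) (m : forall j : 'I_d, 'I_(alpha j) -> nat)
    (charK : [pchar K] =i pred0)
    (d_ge1 : (1 <= d)%N)
    (lambda_inj : injective lambda)
    (alpha_noninc : forall j k : 'I_d, (j <= k)%N -> (alpha k <= alpha j)%N)
    (alpha_ge1 : forall j : 'I_d, (1 <= alpha j)%N)
    (m_ge1 : forall (j : 'I_d) (i : 'I_(alpha j)), (1 <= m j i)%N) :
  let I := minors_ideal 2 (jordan_matrix lambda m) in
  let c := if d == 1%N then (num_vars m - num_blocks alpha)%N
           else (num_vars m - 1)%N in
  is_cd I c /\ is_ara I c.
Proof.
move=> I c.
pose X (u : 'I_(num_vars m)) : {mpoly K[num_vars m]} := 'X_u.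
pose live := @last_in_block d alpha m; pose col u : nat := @eigen d alpha m u.
pose g := colored_gens X live col.
have hI : is_ideal I by apply: ideal_gen_ideal.
have Ig : forall r, I r -> in_span g r := @jordan_minors_sub _ _ lambda _ m.
have gI : forall y, y \in g -> radical I y := jordan_gens_radical lambda_inj.
have [E] := injective_resolution_exists (@mpolyC (num_vars m) K)
  ({mpoly K[num_vars m]}^o : lmodType _).
have [d1|d1] := eqVneq d 1%N.
  (* A single color has no edges, so only the dead variables remain; they form a regular
     sequence. *)
  have gE : g = [seq X u | u <- enum [predC live]].
    have col0 u : col u = 0%N.
      by have := ltn_ord (@eigen d alpha m u); rewrite -/(col u); lia.
    rewrite /g /colored_gens (@eq_enum _ _ pred0) ?enum0 ?cats0 // => p.
    by rewrite unfold_in /edge !col0 eqxx !andbF.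
  have sE : size (enum [predC live]) = c.
    rewrite -cardE /c ifT; last exact/eqP.
    by rewrite -(card_last_in_block m_ge1) -/live -(addKn #|live| #|_|) cardC card_ord.
  have sg : size g = c by rewrite gE size_map.
  rewrite -sg; apply: (cd_ara_of_generators hI Ig gI _ _ _).
  - by move=> y /in_span_mem.
  - by move=> y /in_span_mem h; apply: radical_sub.
  exists E; rewrite sg -sE.
  have [||x xc xb] := @top_cohomology_vars _ _ (enum [predC live]) I E; last by exists x.
  - exact: enum_uniq.
  - by move=> N x; rewrite (torsionP _ Ig gI) gE.
have eq_c : c = (num_vars m).-1 by rewrite /c (negPf d1) subn1.
(* The last variable of the first block of the k-th eigenvalue, counted from 0; for d > 1 the
   indices 0 and 1 give live variables of different colors. *)
pose lv (k : nat) (kd : (k < d)%N) := last_var m_ge1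
  (Tagged (fun j => 'I_(alpha j)) (Ordinal (alpha_ge1 (Ordinal kd)))).
have d2 : (1 < d)%N by lia.
have colm u v : live u -> live v -> (u <= v)%N -> (col u <= col v)%N.
  by move=> _ _; apply: eigen_mono.
have [|a [sa ag ga]] := @colored_gens_up_to_radical _ _ X live col colm.
  by exists (lv 0 d_ge1); apply: last_var_last.
have -> : c = size a by rewrite sa.
apply: (cd_ara_of_generators hI Ig gI ag ga _).
exists E; rewrite sa.
have [||x xc xb] := colored_cohomology E colm (I := I); last by exists x.
- exists (lv 0 d_ge1), (lv 1 d2); split; try exact: last_var_last.
  by rewrite /col !eigen_block_var.
- by move=> N x; apply: torsionP.
Qed.
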